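(* Let $k\ge2$ be real and let $N\ge1$. Let $Q_0,\dots,Q_N$ be objects each of which is a dyadic segment, a good dyadic square, or $\{\infty\}$, with vertices $q_{i,1},\dots,q_{i,4}$ (listed with repetition if there are fewer than 4). For every choice of $z_i\in\langle Q_i\rangle$, $i=0,\dots,N$, $$\sum_{0\le a<b\le N}G_k(z_a,z_b)\;\ge\;\sum_{I}\lambda_{i_0}(z_0)\cdots\lambda_{i_N}(z_N)\,\mathcal{E}(I)-\sum_{i=0}^N\sum_{j\ne i}\epsilon(Q_i,Q_j),$$ where the first sum on the right is over all multi-indices $I=(i_0,\dots,i_N)\in\{1,2,3,4\}^{N+1}$ and $\mathcal{E}(I)=\sum_{0\le a<b\le N}G_k(q_{a,i_a},q_{b,i_b})$.
   Context: Stereographic projection $\Sigma(x,y,z)=(x/(1-z),y/(1-z))$, $\Sigma(0,0,1)=\infty$; $\widehat p=\Sigma^{-1}(p)$, $\widehat\infty=(0,0,1)$. $G_k(p,q)=(4-\|\widehat p-\widehat q\|^2)^k$. Dyadic segments: segments of the $x$-axis of $\mathbb{R}^2$ obtained from $[0,4]\times\{0\}$ by repeated bisection. Dyadic squares: obtained from $[-2,2]^2$ by repeated quartering; good if contained in $[-3/2,3/2]^2$ with side length $\le1/2$. $Q$ also denotes its vertex set, $\langle Q\rangle$ its convex hull, $\widehat Q=\Sigma^{-1}(Q)$, $\langle\widehat Q\rangle$ the convex hull of $\widehat Q$ in $\mathbb{R}^3$, $\widehat{\langle Q\rangle}=\Sigma^{-1}(\langle Q\rangle)$; for $Q=\{\infty\}$,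 $\langle Q\rangle=Q$. Stereographic weighting system: for each such $Q$ and each $z\in\langle Q\rangle$, a point $z^*\in\langle\widehat Q\rangle$ closest to $\widehat z$ and numbers $\lambda_i(z)\ge0$ with $\sum_{i=1}^4\lambda_i(z)=1$ and $z^*=\sum_i\lambda_i(z)\widehat q_i$ are fixed once and for all. $d(Q)$ = diameter of $\langle\widehat Q\rangle$; $d_1(Q)$ = longest edge length of $\langle\widehat Q\rangle$; $D_Q$ = smallest closed disk in $\mathbb{R}^2$ whose boundary contains $Q$, $d_2(Q)$ = Euclidean diameter of $\Sigma^{-1}(D_Q)$. $\chi(D,d)=\frac{d^2}{4D}+\frac{d^4}{2D^3}$; $\delta(Q)=\chi(2,d_2)$ for segments, $\max(\chi(1,d_1),\chi(2,d_2))$ for good squares; $d(\{\infty\})=\delta(\{\infty\})=0$. $(Q\cdot Q')_{\max}=\max_{i,j}\widehat q_i\cdot\widehat q'_j+\delta(Q)+\delta(Q')+\delta(Q)\delta(Q')$ for $Q,Q'\ne\{\infty\}$; $(Q\cdot\{\infty\})_{\max}=\max_i\widehat q_i\cdot(0,0,1)$. $T=2+2(Q\cdot Q')_{\max}$; $\epsilon(Q,Q')=\frac12k(k-1)T^{k-2}d(Q)^2+2kT^{k-1}\delta(Q)$, and $\epsilon(\{\infty\},Q')=0$. *)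

(* Defs.v *)
(* R : realType, real powers via powR (0 `^ 0 = 1, 0 `^ a = 0 for a <> 0). *)
From HB Require Import structures.
From mathcomp Require Import all_boot all_order all_algebra.
From mathcomp Require Import classical_sets boolp reals exp.
Set Implicit Arguments. Unset Strict Implicit. Unset Printing Implicit Defensive.
Import Order.TTheory GRing.Theory Num.Theory.
Local Open Scope ring_scope.
Local Open Scope classical_set_scope.

(* Points of the extended plane R^2 ∪ {∞}: None is ∞. *)
Definition ept (R : realType) := option (R * R)%type.
Definition v3 (R : realType) := (R * R * R)%type.

Definition dot3 {R : realType} (a b : v3 R) : R :=
  a.1.1 * b.1.1 + a.1.2 * b.1.2 + a.2 * b.2.
Definition sub3 {R : realType} (a b : v3 R) : v3 R :=
  (a.1.1 - b.1.1, a.1.2 - b.1.2, a.2 - b.2).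
Definition sqdist3 {R : realType} (a b : v3 R) : R := dot3 (sub3 a b) (sub3 a b).
Definition dist3 {R : realType} (a b : v3 R) : R := Num.sqrt (sqdist3 a b).
Definition dist2 {R : realType} (a b : R * R) : R :=
  Num.sqrt ((a.1 - b.1) ^+ 2 + (a.2 - b.2) ^+ 2).

(* Inverse stereographic projection Σ^{-1}, with Σ(x,y,z) = (x/(1-z), y/(1-z)). *)
Definition isp {R : realType} (p : ept R) : v3 R :=
  match p with
  | None => (0, 0, 1)
  | Some (x, y) =>
      let s := 1 + x ^+ 2 + y ^+ 2 in (2 * x / s, 2 * y / s, (x ^+ 2 + y ^+ 2 - 1) / s)
  end.

Definition Gk {R : realType} (k : R) (p q : ept R) : R :=
  (4 - sqdist3 (isp p) (isp q)) `^ k.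

(* Cells: Seg n m = the dyadic segment [4m/2^n, 4(m+1)/2^n] x {0} (n bisections of [0,4]x{0});
   Sq n i j = the dyadic square [-2+4i/2^n, -2+4(i+1)/2^n] x [-2+4j/2^n, -2+4(j+1)/2^n]
   (n quarterings of [-2,2]^2); Inf = {∞}. *)
Inductive cell := Seg of nat & nat | Sq of nat & nat & nat | Inf.

Definition dy {R : realType} (n m : nat) : R := 4 * m%:R / 2 ^+ n.

Definition valid_cell (R : realType) (c : cell) : Prop :=
  match c with
  | Seg n m => (m < 2 ^ n)%N
  | Sq n i j => (i < 2 ^ n)%N /\ (j < 2 ^ n)%N /\
      (-(3/2) <= -2 + dy n i :> R) /\ (-2 + dy n i.+1 <= 3/2 :> R) /\
      (-(3/2) <= -2 + dy n j :> R) /\ (-2 + dy n j.+1 <= 3/2 :> R) /\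
      (dy n 1 <= 1/2 :> R)
  | Inf => True
  end.

(* Coordinates of the vertices q_1..q_4 (indices 0..3), with repetition for segments;
   for squares listed in cyclic order around the square. *)
Definition vertR {R : realType} (c : cell) (i : 'I_4) : R * R :=
  match c with
  | Seg n m => if odd i then (dy n m.+1, 0) else (dy n m, 0)
  | Sq n a b =>
      let x0 := -2 + dy n a in let x1 := -2 + dy n a.+1 in
      let y0 := -2 + dy n b in let y1 := -2 + dy n b.+1 in
      match val i with
      | 0 => (x0, y0) | 1 => (x1, y0) | 2 => (x1, y1) | _ => (x0, y1)
      end
  | Inf => (0, 0)
  end.

Definition vert {R : realType} (c : cell) (i : 'I_4) : ept R :=
  match c with Inf => None | _ => Some (vertR c i) end.

Definition is_weights {R : realType} (mu : 'I_4 -> R) : Prop :=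
  (forall i, 0 <= mu i) /\ \sum_(i < 4) mu i = 1.

Definition comb3 {R : realType} (c : cell) (mu : 'I_4 -> R) : v3 R :=
  (\sum_(i < 4) mu i * (isp (vert c i)).1.1,
   \sum_(i < 4) mu i * (isp (vert c i)).1.2,
   \sum_(i < 4) mu i * (isp (vert c i)).2).

Definition in_hull {R : realType} (c : cell) (z : ept R) : Prop :=
  match c with
  | Inf => z = None
  | _ => exists mu : 'I_4 -> R, is_weights mu /\
          z = Some (\sum_(i < 4) mu i * (vertR c i).1, \sum_(i < 4) mu i * (vertR c i).2)
  end.

Definition hullS {R : realType} (c : cell) : set (v3 R) :=
  [set w | exists mu : 'I_4 -> R, is_weights mu /\ w = comb3 c mu].

Definition weighting_system {R : realType} (lam : cell -> ept R -> 'I_4 -> R) : Prop :=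
  forall c, valid_cell R c -> forall z, in_hull c z ->
    is_weights (lam c z) /\
    forall w, hullS c w -> dist3 (isp z) (comb3 c (lam c z)) <= dist3 (isp z) w.

Definition diam {R : realType} (S : set (v3 R)) : R :=
  sup [set r | exists a b, S a /\ S b /\ r = dist3 a b].

Definition dQ {R : realType} (c : cell) : R :=
  match c with Inf => 0 | _ => diam (hullS c) end.

Definition d1Q {R : realType} (c : cell) : R :=
  \big[Num.max/0]_(i < 4)
     dist3 (isp (vert c i)) (isp (vert c (inZp i.+1 : 'I_4))).

(* D_Q: smallest closed disk (center, radius) whose boundary circle contains Q *)
Definition DQ_spec {R : realType} (c : cell) (D : (R * R) * R) : Prop :=
  0 <= D.2 /\ (forall i, dist2 (vertR c i) D.1 = D.2) /\
  (forall D' : (R * R) * R, (forall i, dist2 (vertR c i) D'.1 = D'.2) -> D.2 <= D'.2).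
Definition DQ {R : realType} (c : cell) : (R * R) * R := xget ((0, 0), 0) (DQ_spec c).

Definition d2Q {R : realType} (c : cell) : R :=
  diam [set isp (Some p) | p in [set p : R * R | dist2 p (DQ c).1 <= (DQ c).2]].

Definition chi {R : realType} (D d : R) : R := d ^+ 2 / (4 * D) + d ^+ 4 / (2 * D ^+ 3).

Definition deltaQ {R : realType} (c : cell) : R :=
  match c with
  | Seg _ _ => chi 2 (d2Q c)
  | Sq _ _ _ => Num.max (chi 1 (d1Q c)) (chi 2 (d2Q c))
  | Inf => 0
  end.

Definition maxdot {R : realType} (c c' : cell) : R :=
  \big[Num.max/dot3 (isp (vert c ord0)) (isp (vert c' ord0))]_(i < 4)
   \big[Num.max/dot3 (isp (vert c ord0)) (isp (vert c' ord0))]_(j < 4)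
     dot3 (isp (vert c i)) (isp (vert c' j)).

(* (Q.Q')_max  (the case Q = {∞} is never used: ε({∞},Q') = 0) *)
Definition dotmax {R : realType} (c c' : cell) : R :=
  match c, c' with
  | Inf, _ => 0
  | _, Inf => \big[Num.max/dot3 (isp (vert c ord0)) (0, 0, 1)]_(i < 4)
                 dot3 (isp (vert c i)) (0, 0, 1)
  | _, _ => maxdot c c' + deltaQ c + deltaQ c' + deltaQ c * deltaQ c'
  end.

Definition epsQ {R : realType} (k : R) (c c' : cell) : R :=
  match c with
  | Inf => 0
  | _ => let T := 2 + 2 * dotmax c c' in
         1 / 2 * k * (k - 1) * T `^ (k - 2) * dQ c ^+ 2 + 2 * k * T `^ (k - 1) * deltaQ c
  end.

Definition energyI {R : realType} (k : R) (N : nat) (Q : 'I_N.+1 -> cell)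
    (I : {ffun 'I_N.+1 -> 'I_4}) : R :=
  \sum_(a < N.+1) \sum_(b < N.+1 | (a < b)%N)
     Gk k (vert (Q a) (I a)) (vert (Q b) (I b)).

(* Main.v *)
(* Since the weights of each point sum to 1, the multi-index sum is a sum over pairs of
   averages of G_k over pairs of vertices, so the theorem reduces to replacing one point z
   of a pair by the vertices of its cell, at the cost of one term epsilon.  With
   u = 2 + 2 x.w, this compares u^k at the lift of z with its average over the lifted
   vertices.  Taylor's formula with Popoviciu's bound on the variance accounts for the
   passage from the vertices to z*, and the tangent at z* for the passage from z* to
   the lift of z, because these two points are at distance at most delta(Q).

   The last bound only needs some point of the hull within delta(Q).  If the radial
   projection of the lift of z to the plane of the lifted vertices falls in the hull, its
   distance is at most the height of the cap over D_Q, hence at most chi(2, d_2).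
   Otherwise the lift of z lies in a lune over an edge AB, between the great circle through
   A and B and the lift of the line of that edge (a circle through the north pole, of
   radius at least 1/2 for good squares).  The plane through A, B and the lift of z then
   cuts the sphere in a circle of radius at least 1/2, and the distance to the chord AB is
   at most the sagitta, hence at most chi(1, d_1). *)
Require Import Defs.
From HB Require Import structures.
From mathcomp Require Import all_boot all_order all_algebra.
From mathcomp Require Import classical_sets boolp reals topology normedtype derive exp.
From mathcomp Require Import ring lra zify.
Import Order.TTheory GRing.Theory Num.Theory.
Import numFieldNormedType.Exports.
Local Open Scope ring_scope.

(** * Second-order bounds for real powers *)

(** Young's inequality for v and u^(k-1) with the conjugate exponents k and k/(k-1); at k = 1, where
    the second exponent is infinite, the two sides agree. *)
Lemma powR_tangent_le (R : realType) (k u v : R) : 1 <= k -> 0 <= u -> 0 <= v ->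
  u `^ k + k * u `^ (k - 1) * (v - u) <= v `^ k.
Proof.
move=> k1 u0 v0; have k0 : 0 < k by lra.
have [<-|k1'] := eqVneq 1 k; first by rewrite subrr powRr0 !powRr1 //; lra.
have kk : k - 1 != 0 by rewrite subr_eq0 eq_sym.
have kgt : 0 < k - 1 by rewrite lt_neqAle eq_sym kk; lra.
have := @conjugate_powR R v (u `^ (k - 1)) k (k / (k - 1)) v0 (powR_ge0 _ _) k0.
rewrite -powRrM; have -> : (k - 1) * (k / (k - 1)) = k by field.
move=> /(_ (divr_gt0 k0 kgt)) Y.
have {}Y : v * u `^ (k - 1) <= v `^ k / k + u `^ k * (k - 1) / k.
  have -> : u `^ k * (k - 1) / k = u `^ k / (k / (k - 1)).
    by field; rewrite kk gt_eqF.
  by apply: Y; field; rewrite kk gt_eqF.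
have E := mulr_powRB1 u0 k0.
have {}Y : k * (v * u `^ (k - 1)) <= v `^ k + u `^ k * (k - 1).
  have -> : v `^ k + u `^ k * (k - 1) = k * (v `^ k / k + u `^ k * (k - 1) / k).
    by field; rewrite gt_eqF.
  by rewrite ler_pM2l.
rewrite -E in Y *; lra.
Qed.

(** The difference [h] of the two sides vanishes at v. Its derivative is nonpositive to the left of
    v and nonnegative to the right, because x -> k x^(k-1) has slopes at most [c] on (0, T]; the
    mean value theorem concludes. *)
Lemma powR_le_taylor2_pos (R : realType) (k u v T : R) :
  2 <= k -> 0 < u <= T -> 0 < v <= T ->
  u `^ k <= v `^ k + k * v `^ (k - 1) * (u - v)
            + 1 / 2 * k * (k - 1) * T `^ (k - 2) * (u - v) ^+ 2.
Proof.
move=> k2 /andP[u0 uT] /andP[v0 vT].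
pose c := k * (k - 1) * T `^ (k - 2).
pose h (x : R) := v `^ k + k * v `^ (k - 1) * (x - v) + c / 2 * (x - v) ^+ 2 - x `^ k.
pose dh (x : R) := k * v `^ (k - 1) + c * (x - v) - k * x `^ (k - 1).
have hv : h v = 0 by rewrite /h; ring.
suff : 0 <= h u by rewrite /h /c; lra.
have dhE (x : R) : 0 < x -> is_derive x 1 h (dh x).
  move=> x0; have D := is_derive1_powR k x0.
  rewrite /h /dh; apply: is_derive_eq; rewrite /GRing.scale/=; lra.
(* The tangent inequality of exponent k - 1 at the larger point y, followed by y <= T. *)
have slope x y : 0 < x <= T -> 0 < y <= T -> x <= y ->
    y `^ (k - 1) - x `^ (k - 1) <= (k - 1) * T `^ (k - 2) * (y - x).
  move=> /andP[x0 xT] /andP[y0 yT] xy.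
  have := @powR_tangent_le R (k - 1) y x ltac:(lra) (ltW y0) (ltW x0).
  rewrite (_ : k - 1 - 1 = k - 2); last by lra.
  have Ty : y `^ (k - 2) <= T `^ (k - 2).
    by apply: ge0_ler_powR; rewrite ?nnegrE; lra.
  have := ler_wpM2l (_ : 0 <= (k - 1) * (y - x)) Ty.
  move=> /(_ ltac:(apply: mulr_ge0; lra)); lra.
have cont a b : 0 < a -> {within `[a, b], continuous h}%classic.
  move=> a0; apply: derivable_within_continuous => x; rewrite in_itv/= => /andP[ax _].
  have D := dhE x (lt_le_trans a0 ax); exact: ex_derive.
have [uv|vu|->] := ltgtP u v; last by rewrite hv.
- have [x] := MVT uv (fun x h0 => dhE x (lt_trans u0 (andP h0).1)) (cont _ _ u0).
  rewrite in_itv/= hv => /andP[ux xv] E.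
  have := slope x v ltac:(lra) ltac:(lra) ltac:(lra).
  have : 0 <= k * (v - u) by apply: mulr_ge0; lra.
  move=> p /(ler_wpM2l p); move: E; rewrite /dh /c; lra.
- have [x] := MVT vu (fun x h0 => dhE x (lt_trans v0 (andP h0).1)) (cont _ _ v0).
  rewrite in_itv/= hv => /andP[vx xu] E.
  have := slope v x ltac:(lra) ltac:(lra) ltac:(lra).
  have : 0 <= k * (u - v) by apply: mulr_ge0; lra.
  move=> p /(ler_wpM2l p); move: E; rewrite /dh /c; lra.
Qed.

Lemma powR_le_taylor2 (R : realType) (k u v T : R) :
  2 <= k -> 0 <= u <= T -> 0 <= v <= T ->
  u `^ k <= v `^ k + k * v `^ (k - 1) * (u - v)
            + 1 / 2 * k * (k - 1) * T `^ (k - 2) * (u - v) ^+ 2.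
Proof.
move=> k2 /andP[u0 uT] /andP[v0 vT].
have sq x : 0 <= x <= T -> x `^ k <= T `^ (k - 2) * x ^+ 2.
  move=> /andP[x0 xT]; have <- : x `^ (k - 2) * x ^+ 2 = x `^ k.
    by rewrite -powR_mulrn // -powRD ?subrK //; apply/implyP => /eqP; lra.
  by apply: ler_wpM2r; rewrite ?sqr_ge0 // ge0_ler_powR ?nnegrE; lra.
have kn0 : k != 0 by rewrite gt_eqF; lra.
have k1n0 : k - 1 != 0 by rewrite gt_eqF; lra.
have kk : 1 <= 1 / 2 * k * (k - 1) by have := mulr_ge0 (_ : 0 <= k - 2) (_ : 0 <= k); nra.
have [->|un0] := eqVneq u 0.
  have E := mulr_powRB1 v0 (_ : 0 < k); rewrite powR0 //.
  have := sq v ltac:(lra); have := E ltac:(lra).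
  have := powR_ge0 v k.
  set a := v `^ k; set b := v `^ (k - 1); set c := T `^ _ => a0 {}E S.
  (* At u = 0 the linear term is -k v^k, and 1 - k + k(k-1)/2 = (k-1)(k-2)/2 is nonnegative. *)
  have : 0 <= (1 / 2 * k * (k - 1)) * (c * v ^+ 2 - a) by apply: mulr_ge0; lra.
  have : 0 <= (k - 1) * (k - 2) * a by apply: mulr_ge0 => //; apply: mulr_ge0; lra.
  rewrite -E; nra.
have [->|vn0] := eqVneq v 0.
  rewrite !powR0 //; have := sq u ltac:(lra); have := powR_ge0 u k.
  set c := T `^ _ => a0 S.
  have : 0 <= (1 / 2 * k * (k - 1) - 1) * (c * u ^+ 2) by apply: mulr_ge0; lra.
  lra.
by apply: powR_le_taylor2_pos; rewrite // lt_neqAle eq_sym ?un0 ?vn0 /=; apply/andP.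
Qed.

(** * Chords and sections of the unit sphere *)

(** This bounds 1 - sqrt(1 - t), the sagitta of a chord of half-length sqrt t in a unit circle. For
    t >= 4/5 the right-hand side exceeds 1; below, (1 - t/2 - t^2)^2 = 1 - t - t^2 (7/4 - t - t^2)
    with a positive last factor. *)
Lemma one_sub_le_sagitta (R : realType) (x t : R) : 0 <= x -> 0 <= t -> 1 - t <= x ^+ 2 ->
  1 - x <= t / 2 + t ^+ 2.
Proof.
move=> x0 t0 xt; rewrite leNgt; apply/negP => H.
have t1 : t < 4 / 5.
  rewrite ltNge; apply/negP => t45.
  have : 0 <= (t - 4 / 5) * (t + 4 / 5) by apply: mulr_ge0; lra.
  nra.
have t2 : t ^+ 2 <= 4 / 5 * t by rewrite expr2; apply: ler_wpM2r; lra.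
have x1 : x ^+ 2 <= (1 - t / 2 - t ^+ 2) ^+ 2.
  by rewrite ler_sqr ?nnegrE; lra.
have x2 : x ^+ 2 < (1 - t / 2 - t ^+ 2) ^+ 2.
  by rewrite ltr_sqr ?nnegrE; lra.
have : 0 <= t ^+ 2 * (7 / 4 - t - t ^+ 2) by apply: mulr_ge0; [exact: sqr_ge0|lra].
lra.
Qed.

(** With [e] the squared half-chord in a circle of radius 1/2, [k] is the distance from the centre
    to the chord, and the hypotheses give (eta + k)^2 <= 1/4. Scaling by 2 reduces the sagitta 1/2 -
    k to [one_sub_le_sagitta]. *)
Lemma half_circle_sagitta (R : realType) (e eta S : R) : 0 <= e <= 1 / 4 -> 0 <= eta ->
  0 <= S -> eta ^+ 2 + 2 * S <= e -> (1 / 4 - e) * eta ^+ 2 <= S ^+ 2 ->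
  eta <= e + 8 * e ^+ 2.
Proof.
move=> /andP[e0 e1] eta0 S0 h1 h2; pose k := Num.sqrt (1 / 4 - e).
have k0 : 0 <= k := sqrtr_ge0 _.
have k2 : k ^+ 2 = 1 / 4 - e by rewrite sqr_sqrtr; lra.
have kS : k * eta <= S.
  by rewrite -ler_sqr ?nnegrE ?mulr_ge0 // exprMn k2.
have : eta + k <= 1 / 2.
  rewrite -ler_sqr ?nnegrE; [|lra|lra].
  rewrite sqrrD k2; lra.
have := @one_sub_le_sagitta R (2 * k) (4 * e).
rewrite !exprMn k2; lra.
Qed.

Definition cross3 {R : realType} (a b : v3 R) : v3 R :=
  (a.1.2 * b.2 - a.2 * b.1.2, a.2 * b.1.1 - a.1.1 * b.2, a.1.1 * b.1.2 - a.1.2 * b.1.1).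

Definition lin3 {R : realType} (V : 'I_4 -> v3 R) (mu : 'I_4 -> R) : v3 R :=
  (\sum_(i < 4) mu i * (V i).1.1, \sum_(i < 4) mu i * (V i).1.2,
   \sum_(i < 4) mu i * (V i).2).

Lemma dot3C (R : realType) (a b : v3 R) : dot3 a b = dot3 b a.
Proof. rewrite /dot3; ring. Qed.

Lemma dot3_lin3 (R : realType) (V : 'I_4 -> v3 R) mu n :
  dot3 (lin3 V mu) n = \sum_(i < 4) mu i * dot3 (V i) n.
Proof. rewrite /dot3 /lin3 /= !big_ord_recr !big_ord0 /=; ring. Qed.

Lemma dot3_sq_ge0 (R : realType) (a : v3 R) : 0 <= dot3 a a.
Proof. by rewrite /dot3 -!expr2 !addr_ge0 ?sqr_ge0. Qed.

Lemma dot3_cauchy (R : realType) (a b : v3 R) :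
  dot3 a b ^+ 2 <= dot3 a a * dot3 b b.
Proof.
have := dot3_sq_ge0 R (cross3 a b).
have -> : dot3 (cross3 a b) (cross3 a b) = dot3 a a * dot3 b b - dot3 a b ^+ 2.
  rewrite /dot3 /cross3 /=; ring.
by rewrite subr_ge0.
Qed.

Lemma sqr_le1_norm (R : realType) (x : R) : x ^+ 2 <= 1 -> -1 <= x <= 1.
Proof. by move=> h; rewrite -ler_norml -(expr_le1 (n := 2)) // real_normK ?num_real. Qed.

Lemma dot3_unit_bound (R : realType) (a b : v3 R) : dot3 a a = 1 -> dot3 b b = 1 ->
  -1 <= dot3 a b <= 1.
Proof.
by move=> ha hb; apply: sqr_le1_norm; rewrite (le_trans (dot3_cauchy _ _ _)) // ha hb mulr1.
Qed.

Lemma dot3_le_dist3 (R : realType) (a b w : v3 R) : dot3 w w = 1 ->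
  dot3 a w - dot3 b w <= dist3 a b.
Proof.
move=> hw; rewrite (le_trans (ler_norm _)) // -ler_sqr ?nnegrE ?sqrtr_ge0 //.
rewrite real_normK ?num_real // sqr_sqrtr ?dot3_sq_ge0 //.
have := dot3_cauchy R (sub3 a b) w; rewrite hw mulr1; apply: le_trans.
rewrite le_eqVlt; apply/orP; left; apply/eqP; rewrite /dot3 /sub3 /=; ring.
Qed.

Lemma sqdist3_unit (R : realType) (a b : v3 R) : dot3 a a = 1 -> dot3 b b = 1 ->
  sqdist3 a b = 2 - 2 * dot3 a b.
Proof.
have -> : sqdist3 a b = dot3 a a + dot3 b b - 2 * dot3 a b.
  rewrite /sqdist3 /dot3 /sub3 /=; ring.
by move=> -> ->; lra.
Qed.

Lemma dist3_le (R : realType) (a b : v3 R) x : 0 <= x -> sqdist3 a b <= x ^+ 2 -> dist3 a b <= x.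
Proof. by move=> x0 h; rewrite -ler_sqr ?nnegrE ?sqrtr_ge0 // sqr_sqrtr ?dot3_sq_ge0. Qed.

(* The witness is the radial projection of P to the plane n.x = h0; its norm is at least
   the distance h0 / |n| of that plane to the origin. *)
Lemma radial_near (R : realType) (V : 'I_4 -> v3 R) (P n : v3 R) (al : 'I_4 -> R) (h0 t : R) :
  (forall i, dot3 (V i) (V i) = 1) -> dot3 P P = 1 -> (forall i, 0 <= al i) ->
  P = lin3 V al -> (forall i, dot3 (V i) n = h0) -> 0 < h0 -> 0 <= t ->
  (1 - t) * dot3 n n <= h0 ^+ 2 ->
  exists mu, is_weights mu /\ dist3 P (lin3 V mu) <= t / 2 + t ^+ 2.
Proof.
move=> hV hP al0 EP hn h00 t0 ht.
pose s := \sum_(i < 4) al i.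
(* 1 = P.P is the sum of the al_i (V_i.P), and each V_i.P is at most 1. *)
have s1 : 1 <= s.
  rewrite -hP {1}EP dot3_lin3; apply: ler_sum => i _.
  by rewrite ler_piMr //; have /andP[] := dot3_unit_bound R (V i) P (hV i) hP.
have s0 : s != 0 by rewrite gt_eqF; lra.
(* Cauchy-Schwarz for P.n = h0 s; together with [ht] it yields (1 - t) s^2 <= 1. *)
have hs : (h0 * s) ^+ 2 <= dot3 n n.
  have := dot3_cauchy R P n; rewrite hP mul1r {1}EP dot3_lin3.
  by under eq_bigr do rewrite hn; rewrite -mulr_suml mulrC.
exists (fun i => al i / s); split.
  split; first by move=> i; rewrite divr_ge0 //; lra.
  by rewrite -mulr_suml divff.
have si1 : s^-1 <= 1 by rewrite invf_le1 //; lra.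
have si0 : 0 <= s^-1 by rewrite invr_ge0; lra.
have bd : 1 - s^-1 <= t / 2 + t ^+ 2.
  apply: one_sub_le_sagitta => //.
  have [t1|t1] := leP 1 t; first by rewrite (le_trans _ (sqr_ge0 _)) //; lra.
  rewrite exprVn -[X in _ <= X]mul1r ler_pdivlMr.
    suff : (1 - t) * s ^+ 2 <= 1 by lra.
    rewrite -(ler_pM2l (_ : 0 < h0 ^+ 2)) ?exprn_gt0 // mulr1.
    apply: le_trans ht; rewrite mulrCA -exprMn; apply: ler_wpM2l => //; lra.
  by rewrite exprn_gt0 //; lra.
apply: le_trans bd; apply: dist3_le; first by lra.
have -> : lin3 V (fun i => al i / s) = (s^-1 * P.1.1, s^-1 * P.1.2, s^-1 * P.2).
  rewrite EP /lin3 /= !mulr_sumr; congr (_, _, _); apply: eq_bigr => i _; ring.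
have -> : sqdist3 P (s^-1 * P.1.1, s^-1 * P.1.2, s^-1 * P.2) = (1 - s^-1) ^+ 2 * dot3 P P.
  rewrite /sqdist3 /dot3 /sub3 /=; ring.
by rewrite hP mulr1.
Qed.

(* The signs say that the plane ABP lies between the plane through A, B and the origin and
   the plane N.x = g; both cut the sphere in circles of radius at least 1/2. *)
Lemma edge_near (R : realType) (A B P N : v3 R) (g : R) :
  dot3 A A = 1 -> dot3 B B = 1 -> dot3 P P = 1 ->
  dot3 N A = g -> dot3 N B = g -> dot3 N P <= g -> g < 0 ->
  4 * g ^+ 2 <= 3 * dot3 N N -> 0 <= dot3 P (cross3 A B) -> 0 < dot3 N (cross3 A B) ->
  0 < sqdist3 A B <= 1 ->
  exists th, 0 <= th <= 1 /\
    dist3 P ((1 - th) * A.1.1 + th * B.1.1, (1 - th) * A.1.2 + th * B.1.2,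
             (1 - th) * A.2 + th * B.2) <= chi 1 (dist3 A B).
Proof.
move=> hA hB hP NA NB NP g0 gN; set n2 := cross3 A B => P2 N2.
(* [e] is the square of half the chord AB. *)
pose q := dot3 A B; pose e := (1 - q) / 2; pose K := dot3 n2 n2.
rewrite sqdist3_unit // -/q => /andP[q1 q2].
have KE : K = (1 - q) * (1 + q).
  have -> : K = dot3 A A * dot3 B B - q ^+ 2 by rewrite /K /n2 /cross3 /q /dot3 /=; ring.
  by rewrite hA hB; ring.
have K0 : 0 < K by rewrite KE; apply: mulr_gt0; lra.
have Kn0 : K != 0 by rewrite gt_eqF.
(* Coordinates of P in the basis A, B, n2, from the Gram matrix of A and B and the orthogonality of
   n2 to both. *)
pose al := (dot3 P A - dot3 P B * q) / K.
pose be := (dot3 P B - dot3 P A * q) / K.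
pose ga := dot3 P n2 / K; pose nu := dot3 N n2.
have ga0 : 0 <= ga by rewrite divr_ge0 // ltW.
have PE : P = (al * A.1.1 + be * B.1.1 + ga * n2.1.1, al * A.1.2 + be * B.1.2 + ga * n2.1.2,
               al * A.2 + be * B.2 + ga * n2.2).
  have alE : al * K = dot3 P A * dot3 B B - dot3 P B * q by rewrite divfK // hB mulr1.
  have beE : be * K = dot3 P B * dot3 A A - dot3 P A * q by rewrite divfK // hA mulr1.
  have gaE : ga * K = dot3 P n2 by rewrite divfK.
  have D x y z : (al * x + be * y + ga * z) * K = al * K * x + be * K * y + ga * K * z by ring.
  rewrite [LHS]surjective_pairing [P.1]surjective_pairing.
  by congr (_, _, _); apply: (mulIf Kn0); rewrite D alE beE gaE /K /q /n2 /cross3 /dot3 /=; ring.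
clearbody al be ga.
(* al A + be B = sg (A + B)/2 + ta (B - A)/2, where A + B, B - A and n2 are mutually orthogonal. *)
pose sg := al + be; pose ta := be - al.
have PPE : sg ^+ 2 * (1 + q) / 2 + ta ^+ 2 * (1 - q) / 2 + ga ^+ 2 * K = 1.
  rewrite -[RHS]hP PE.
  have -> : sg ^+ 2 * (1 + q) / 2 = sg ^+ 2 * ((dot3 A A + 2 * dot3 A B + dot3 B B) / 4)
    by rewrite hA hB /q; field.
  have -> : ta ^+ 2 * (1 - q) / 2 = ta ^+ 2 * ((dot3 A A - 2 * dot3 A B + dot3 B B) / 4)
      + sg * ta * (dot3 B B - dot3 A A) / 2
    by rewrite hA hB /q; field.
  rewrite /sg /ta /K /n2 /cross3 /dot3 /=; by field.
have NPE : dot3 N P = g * sg + ga * nu.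
  have -> : g * sg = dot3 N A * al + dot3 N B * be by rewrite NA NB /sg; ring.
  rewrite PE /nu /dot3 /=; ring.
have NNE : K * dot3 N N = nu ^+ 2 + 2 * g ^+ 2 * (1 - q).
  have -> : 2 * g ^+ 2 * (1 - q) = dot3 N A ^+ 2 * dot3 B B
     - 2 * (dot3 N A * dot3 N B * q) + dot3 N B ^+ 2 * dot3 A A.
    by rewrite NA NB hA hB; ring.
  rewrite /K /nu /n2 /q /cross3 /dot3 /=; ring.
have h1 : ga * nu <= - g * (sg - 1) by move: NP; rewrite NPE; lra.
have sg1 : 0 <= sg - 1.
  rewrite -(pmulr_rge0 _ (_ : 0 < - g)) ?oppr_gt0 //.
  by apply: le_trans h1; rewrite mulr_ge0 // ltW.
have h2 : (ga * nu) ^+ 2 <= (- g * (sg - 1)) ^+ 2.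
  rewrite ler_sqr // nnegrE; [by rewrite mulr_ge0 // ltW|by rewrite mulr_ge0 //; lra].
pose G := ga ^+ 2 * K.
have G0 : 0 <= G by rewrite mulr_ge0 ?sqr_ge0 // ltW.
(* Together with G = |ga n2|^2, this says that ABP is at distance at most sqrt 3 / 2
   from the origin. *)
have h3 : G * (1 - 4 * e) <= 3 * (1 - e) * (sg - 1) ^+ 2.
  have g2 : 0 < g ^+ 2 by rewrite exprn_even_gt0 //= lt_eqF.
  rewrite -(ler_pM2l g2).
  have gq : g ^+ 2 * (1 - 4 * e) * (1 - q) * 2 <= 3 * nu ^+ 2.
    have := ler_wpM2l (ltW K0) gN; rewrite mulrCA [K * (3 * _)]mulrCA NNE KE /e; lra.
  have := ler_wpM2l (sqr_ge0 ga) gq.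
  move: h2; rewrite !exprMn sqrrN => h2.
  rewrite /G KE.
  have q3 : 0 <= (1 + q) / 2 by lra.
  move=> h4; have := ler_wpM2l q3 h4; have := ler_wpM2l q3 h2; rewrite /e; lra.
(* W is the foot of the perpendicular from P to the line AB: P - W = (sg - 1)(A + B)/2 + ga n2. *)
pose W := ((1 - (1 + ta) / 2) * A.1.1 + (1 + ta) / 2 * B.1.1,
  (1 - (1 + ta) / 2) * A.1.2 + (1 + ta) / 2 * B.1.2, (1 - (1 + ta) / 2) * A.2 + (1 + ta) / 2 * B.2).
have dW : sqdist3 P W = (sg - 1) ^+ 2 * (1 - e) + G.
  have -> : (sg - 1) ^+ 2 * (1 - e) = (sg - 1) ^+ 2 * ((dot3 A A + 2 * dot3 A B + dot3 B B) / 4)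
    by rewrite hA hB /e /q; field.
  rewrite PE /W /G /K /sg /ta /sqdist3 /sub3 /n2 /cross3 /dot3 /=; by field.
(* This restates |P| = 1. The left side is nonnegative, so |ta| <= 1 and W lies on the chord. *)
have pw : sqdist3 P W + 2 * ((1 - e) * (sg - 1)) = e * (1 - ta ^+ 2).
  rewrite dW /e; move: PPE; rewrite -/G; lra.
have e0 : 0 < e by rewrite /e; lra.
have e1 : 0 <= 1 - e by rewrite /e; lra.
have S0 : 0 <= (1 - e) * (sg - 1) by exact: mulr_ge0.
have ta1 : -1 <= ta <= 1.
  apply: sqr_le1_norm; rewrite -subr_ge0 -(pmulr_rge0 _ e0) -pw.
  by rewrite addr_ge0 ?dot3_sq_ge0 // mulr_ge0.
exists ((1 + ta) / 2); split; first by lra.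
rewrite -/W.
have chiE : chi 1 (dist3 A B) = e + 8 * e ^+ 2.
  have d2 : dist3 A B ^+ 2 = 4 * e.
    by rewrite /dist3 sqr_sqrtr ?dot3_sq_ge0 // sqdist3_unit // /e -/q; lra.
  rewrite /chi -[4%N]/(2 * 2)%N exprM d2; by field.
have dd : dist3 P W ^+ 2 = sqdist3 P W by rewrite sqr_sqrtr ?dot3_sq_ge0.
rewrite chiE; apply: (@half_circle_sagitta R e _ ((1 - e) * (sg - 1))) => //.
- by rewrite /e; lra.
- exact: sqrtr_ge0.
- by rewrite dd pw; have := mulr_ge0 (ltW e0) (sqr_ge0 ta); lra.
- rewrite dd dW; move: h3; rewrite exprMn; lra.
Qed.

(** * Inverse stereographic projection *)

Definition sden {R : realType} (p : R * R) : R := 1 + p.1 ^+ 2 + p.2 ^+ 2.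

Lemma sden_ge1 (R : realType) (p : R * R) : 1 <= sden p.
Proof. by rewrite /sden -addrA lerDl addr_ge0 ?sqr_ge0. Qed.

Lemma sden_neq0 (R : realType) (p : R * R) : sden p != 0.
Proof. by rewrite gt_eqF // (lt_le_trans ltr01) // sden_ge1. Qed.

Lemma ispE (R : realType) (p : R * R) :
  isp (Some p) = (2 * p.1 / sden p, 2 * p.2 / sden p, (p.1 ^+ 2 + p.2 ^+ 2 - 1) / sden p).
Proof. by case: p. Qed.

Lemma isp_unit (R : realType) (p : ept R) : dot3 (isp p) (isp p) = 1.
Proof.
case: p => [p|]; last by rewrite /dot3 /=; ring.
rewrite ispE /dot3 /=; have := sden_neq0 R p; rewrite /sden => h; field; exact: h.
Qed.

Lemma sqdist3_isp (R : realType) (p q : R * R) :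
  sqdist3 (isp (Some p)) (isp (Some q)) =
  4 * ((p.1 - q.1) ^+ 2 + (p.2 - q.2) ^+ 2) / (sden p * sden q).
Proof.
rewrite sqdist3_unit ?isp_unit // !ispE /dot3 /=.
have := sden_neq0 R p; have := sden_neq0 R q; rewrite /sden => h h'; field; exact/andP.
Qed.

(* Determinant of the vectors (2x, 2y, x^2 + y^2 - 1), the positive multiples of
   the lifted points. *)
Definition det_lift {R : realType} (p q z : R * R) : R :=
  4 * ((p.1 * q.2 - p.2 * q.1) * (z.1 ^+ 2 + z.2 ^+ 2 - 1)
     + (q.1 * z.2 - q.2 * z.1) * (p.1 ^+ 2 + p.2 ^+ 2 - 1)
     + (z.1 * p.2 - z.2 * p.1) * (q.1 ^+ 2 + q.2 ^+ 2 - 1)).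

Lemma dot3_cross3_isp (R : realType) (p q z : R * R) :
  dot3 (isp (Some z)) (cross3 (isp (Some p)) (isp (Some q))) =
  det_lift p q z / sden p / sden q / sden z.
Proof. rewrite !ispE /dot3 /cross3 /det_lift /=; ring. Qed.

(** [cr] is the offset of z across the edge pq, and the factors of the last product are its offsets
    along the edge from p and from q, all times the edge length. In these terms the sign of the
    determinant can be read off. *)
Lemma det_lift_edge (R : realType) (p q z : R * R) :
  let u := (q.1 - p.1, q.2 - p.2) in let g := p.1 * q.2 - p.2 * q.1 in
  let cr := u.1 * (z.2 - p.2) - u.2 * (z.1 - p.1) in
  (u.1 ^+ 2 + u.2 ^+ 2) * det_lift p q z =
  4 * (g * cr ^+ 2 - cr * (u.1 ^+ 2 + u.2 ^+ 2) * (1 + p.1 * q.1 + p.2 * q.2)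
       - g * ((z.1 - p.1) * u.1 + (z.2 - p.2) * u.2) *
             ((q.1 - z.1) * u.1 + (q.2 - z.2) * u.2)).
Proof. rewrite /det_lift /=; ring. Qed.

(** A positive determinant puts the lift of z beyond the great circle through A and B, which forces
    g < 0. Then [edge_near] applies with the plane through A, B and the north pole; g^2 <= 3 l2 says
    that its circle has radius at least 1/2. *)
Lemma lift_edge_near (R : realType) (p q z : R * R) :
  let u := (q.1 - p.1, q.2 - p.2) in let g := p.1 * q.2 - p.2 * q.1 in
  let cr := u.1 * (z.2 - p.2) - u.2 * (z.1 - p.1) in
  let l2 := u.1 ^+ 2 + u.2 ^+ 2 in let pq := p.1 * q.1 + p.2 * q.2 in
  0 < l2 <= 1 / 4 -> 0 <= cr <= l2 -> g <= 1 + pq -> 0 < 1 + pq -> g ^+ 2 <= 3 * l2 ->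
  0 <= (z.1 - p.1) * u.1 + (z.2 - p.2) * u.2 ->
  0 <= (q.1 - z.1) * u.1 + (q.2 - z.2) * u.2 ->
  0 < det_lift p q z ->
  let A := isp (Some p) in let B := isp (Some q) in
  exists th, 0 <= th <= 1 /\
    dist3 (isp (Some z))
      ((1 - th) * A.1.1 + th * B.1.1, (1 - th) * A.1.2 + th * B.1.2,
       (1 - th) * A.2 + th * B.2) <= chi 1 (dist3 A B).
Proof.
move=> u g cr l2 pq /andP[l0 l1] /andP[cr0 cr1] gpq pq0 g3 w1 w2 D0.
have sp := sden_ge1 R p; have sq := sden_ge1 R q; have sz := sden_ge1 R z.
have sp0 := sden_neq0 R p; have sq0 := sden_neq0 R q; have sz0 := sden_neq0 R z.
(* For g >= 0 the right-hand side of [det_lift_edge] is nonpositive, by cr <= l2 and g <= 1 + pq. *)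
have g0 : g < 0.
  rewrite ltNge; apply/negP => g0.
  have := mulr_gt0 l0 D0; rewrite /l2 det_lift_edge -/g -/cr -/l2.
  have -> : 1 + p.1 * q.1 + p.2 * q.2 = 1 + pq by rewrite /pq; ring.
  have := mulr_ge0 (mulr_ge0 g0 w1) w2.
  have : 0 <= cr * (l2 * (1 + pq) - g * cr).
    apply: mulr_ge0 => //; rewrite subr_ge0.
    apply: (le_trans (ler_wpM2l g0 cr1)); rewrite mulrC ler_pM2l //.
  lra.
(* The north pole also satisfies N.x = g, so this plane cuts the sphere in the lift of the line
   pq. *)
pose N : v3 R := (u.2, - u.1, g).
have NE v : dot3 N (isp (Some v)) =
    g - 2 * (u.1 * (v.2 - p.2) - u.2 * (v.1 - p.1)) / sden v.
  rewrite ispE /dot3 /= /g; have := sden_neq0 R v; rewrite /sden => h; by field.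
move=> A B; apply: (@edge_near R A B (isp (Some z)) N g); rewrite ?isp_unit //.
- by rewrite NE; ring.
- by rewrite NE /=; ring.
- rewrite NE gerBl divr_ge0 ?mulr_ge0 //; lra.
- have -> : dot3 N N = l2 + g ^+ 2 by rewrite /N /dot3 /l2 /=; ring.
  lra.
- by rewrite dot3_cross3_isp !divr_ge0 //; lra.
- have -> : dot3 N (cross3 A B) = 2 * l2 * (1 + pq) / sden p / sden q.
    rewrite /A /B !ispE /cross3 /dot3 /N /l2 /pq /g /u /=; ring.
  by rewrite !divr_gt0 ?mulr_gt0 //; lra.
- rewrite sqdist3_isp.
  have -> : (p.1 - q.1) ^+ 2 + (p.2 - q.2) ^+ 2 = l2 by rewrite /l2 /=; ring.
  have s1 : 1 <= sden p * sden q by apply: mulr_ege1.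
  apply/andP; split; first by rewrite divr_gt0 ?mulr_gt0 //; lra.
  rewrite ler_pdivrMr; lra.
Qed.

(** Cramer's rule in the basis A, B, C: the coefficients are quotients of determinants of equal
    sign, and [co] adds the factors [sden] that normalise the vectors. *)
Lemma lift_in_triangle (R : realType) (p0 p1 p2 z : R * R) :
  det_lift p0 p1 p2 < 0 -> det_lift p1 p2 z <= 0 -> det_lift p2 p0 z <= 0 ->
  det_lift p0 p1 z <= 0 ->
  let A := isp (Some p0) in let B := isp (Some p1) in let C := isp (Some p2) in
  exists a b c, [/\ 0 <= a, 0 <= b, 0 <= c &
    isp (Some z) = (a * A.1.1 + b * B.1.1 + c * C.1.1,
      a * A.1.2 + b * B.1.2 + c * C.1.2, a * A.2 + b * B.2 + c * C.2)].
Proof.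
move=> D h0 h1 h2 A B C.
have Dn0 : det_lift p0 p1 p2 != 0 by rewrite lt_eqF.
pose co d s := d / det_lift p0 p1 p2 * s / sden z.
have co0 d p : d <= 0 -> 0 <= co d (sden p).
  move=> d0; have a0 : 0 <= d / det_lift p0 p1 p2.
    by rewrite -mulrNN mulr_ge0 ?oppr_ge0 // invr_le0 ltW.
  have := sden_ge1 R p; have := sden_ge1 R z => sz sp.
  by apply: divr_ge0; [apply: mulr_ge0 => //|]; lra.
exists (co (det_lift p1 p2 z) (sden p0)), (co (det_lift p2 p0 z) (sden p1)),
  (co (det_lift p0 p1 z) (sden p2)); split; rewrite ?co0 //.
have s0 := sden_neq0 R p0; have s1 := sden_neq0 R p1; have s2 := sden_neq0 R p2.
have sz := sden_neq0 R z.
have E x0 x1 x2 : co (det_lift p1 p2 z) (sden p0) * (x0 / sden p0) +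
    co (det_lift p2 p0 z) (sden p1) * (x1 / sden p1) +
    co (det_lift p0 p1 z) (sden p2) * (x2 / sden p2) =
    (det_lift p1 p2 z * x0 + det_lift p2 p0 z * x1 + det_lift p0 p1 z * x2)
     / det_lift p0 p1 p2 / sden z.
  by rewrite /co; field; rewrite Dn0 s0 s1 s2 sz.
rewrite /A /B /C !ispE /= !E; congr (_, _, _); congr (_ / _);
  apply: (mulIf Dn0); rewrite divfK // /det_lift /=; ring.
Qed.

(** * Distance from a lifted cell to the hull of its vertices *)

Lemma sum_delta (R : realType) (n : nat) (i : 'I_n) (f : 'I_n -> R) :
  \sum_(k < n) (k == i)%:R * f k = f i.
Proof.
rewrite (bigD1 i) //= eqxx mul1r big1 ?addr0 // => k /negPf ->; exact: mul0r.
Qed.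

Lemma lin3_triple (R : realType) (V : 'I_4 -> v3 R) (i j l : 'I_4) (a b c : R) :
  lin3 V (fun k => a * (k == i)%:R + b * (k == j)%:R + c * (k == l)%:R) =
  (a * (V i).1.1 + b * (V j).1.1 + c * (V l).1.1,
   a * (V i).1.2 + b * (V j).1.2 + c * (V l).1.2,
   a * (V i).2 + b * (V j).2 + c * (V l).2).
Proof.
have E f : \sum_k (a * (k == i)%:R + b * (k == j)%:R + c * (k == l)%:R) * f k
    = a * f i + b * f j + c * f l.
  rewrite -(sum_delta R 4 i f) -(sum_delta R 4 j f) -(sum_delta R 4 l f) !mulr_sumr -!big_split.
  by apply: eq_bigr => k _ /=; ring.
by rewrite /lin3 (E (fun k => (V k).1.1)) (E (fun k => (V k).1.2)) (E (fun k => (V k).2)).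
Qed.

Lemma exists_weights_segment (R : realType) (V : 'I_4 -> v3 R) (i j : 'I_4) (th : R) :
  0 <= th <= 1 -> exists mu, is_weights mu /\
   lin3 V mu = ((1 - th) * (V i).1.1 + th * (V j).1.1, (1 - th) * (V i).1.2 + th * (V j).1.2,
             (1 - th) * (V i).2 + th * (V j).2).
Proof.
move=> /andP[h0 h1].
(* The last term, with coefficient 0, matches the shape of [lin3_triple]. *)
exists (fun k => (1 - th) * (k == i)%:R + th * (k == j)%:R + 0 * (k == j)%:R); split.
  split=> [k|].
    by rewrite mul0r addr0 addr_ge0 // mulr_ge0 ?ler0n // subr_ge0.
  rewrite !big_split -!mulr_sumr /= mul0r addr0.
  have D k : \sum_(l < 4) (l == k)%:R = 1 :> R.
    by have := sum_delta R 4 k (fun=> 1); under eq_bigr do rewrite mulr1.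
  by rewrite !D; ring.
by rewrite lin3_triple !mul0r !addr0.
Qed.

Lemma weighted_sum_le (R : realType) (mu f : 'I_4 -> R) (M : R) : is_weights mu ->
  (forall i, f i <= M) -> \sum_(i < 4) mu i * f i <= M.
Proof.
move=> [mu0 mu1] h; rewrite -[M]mul1r -mu1 mulr_suml; apply: ler_sum => i _.
exact: ler_wpM2l.
Qed.

Lemma weighted_sum_ge (R : realType) (mu f : 'I_4 -> R) (M : R) : is_weights mu ->
  (forall i, M <= f i) -> M <= \sum_(i < 4) mu i * f i.
Proof.
move=> [mu0 mu1] h; rewrite -[M]mul1r -mu1 mulr_suml; apply: ler_sum => i _.
exact: ler_wpM2l.
Qed.

(** In the unit ball distances are at most 2 by the parallelogram law; this boundedness makes the
    [sup] an upper bound. *)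
Lemma diam_ge (R : realType) (S : set (v3 R)) (a b : v3 R) :
  (forall w, S w -> dot3 w w <= 1) -> S a -> S b -> dist3 a b <= diam S.
Proof.
move=> hS Sa Sb; apply: ub_le_sup; last by exists a, b.
exists 2 => _ [x [y [/hS Sx [/hS Sy ->]]]]; apply: dist3_le => //.
have -> : sqdist3 x y = 2 * dot3 x x + 2 * dot3 y y
    - dot3 (x.1.1 + y.1.1, x.1.2 + y.1.2, x.2 + y.2) (x.1.1 + y.1.1, x.1.2 + y.1.2, x.2 + y.2).
  rewrite /sqdist3 /dot3 /sub3 /=; ring.
have := dot3_sq_ge0 R (x.1.1 + y.1.1, x.1.2 + y.1.2, x.2 + y.2); lra.
Qed.

Lemma dist3_le_d2Q (R : realType) (c : cell) (p q : R * R) :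
  dist2 p (DQ c).1 <= (DQ c).2 -> dist2 q (DQ c).1 <= (DQ c).2 ->
  dist3 (isp (Some p)) (isp (Some q)) <= d2Q c.
Proof.
move=> hp hq; apply: diam_ge; [|by exists p|by exists q].
by move=> _ [w _ <-]; rewrite isp_unit.
Qed.

Lemma dist2_sqr (R : realType) (p q : R * R) :
  dist2 p q ^+ 2 = (p.1 - q.1) ^+ 2 + (p.2 - q.2) ^+ 2.
Proof. by rewrite sqr_sqrtr // addr_ge0 ?sqr_ge0. Qed.

(* A circle through two opposite boundary points of a disk is at least as large as the
   disk, so the disk centred at their midpoint is the minimal one. *)
Lemma DQ_spec_antipodal (R : realType) (c : cell) (m : R * R) (i j : 'I_4) :
  (forall l, dist2 (vertR c l) m = dist2 (vertR c i) m) ->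
  (vertR c i).1 + (vertR c j).1 = 2 * m.1 -> (vertR c i).2 + (vertR c j).2 = 2 * m.2 ->
  DQ_spec c (DQ c : (R * R) * R).
Proof.
move=> hm h1 h2; apply: xgetPex; exists (m, dist2 (vertR c i) m); split=> /=.
  exact: sqrtr_ge0.
split=> // D' hD'.
have D0 : 0 <= D'.2 by rewrite -(hD' i) sqrtr_ge0.
rewrite -ler_sqr ?nnegrE ?sqrtr_ge0 //.
have := congr1 (fun x => x ^+ 2) (hD' i); have := congr1 (fun x => x ^+ 2) (hD' j).
rewrite !dist2_sqr.
set x := (vertR c i).1 in h1 *; set y := (vertR c i).2 in h2 *.
have -> : (vertR c j).1 = 2 * m.1 - x by lra.
have -> : (vertR c j).2 = 2 * m.2 - y by lra.
have := sqr_ge0 (m.1 - D'.1.1); have := sqr_ge0 (m.2 - D'.1.2); lra.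
Qed.

Lemma chi_ge0 (R : realType) (D d : R) : 0 < D -> 0 <= chi D d.
Proof.
move=> D0; rewrite /chi addr_ge0 // divr_ge0 ?sqr_ge0 ?exprn_even_ge0 //.
- by rewrite mulr_ge0 ?ltW.
- by rewrite mulr_ge0 ?exprn_ge0 ?ltW.
Qed.

Lemma chi_le (R : realType) (D d d' : R) : 0 < D -> 0 <= d <= d' -> chi D d <= chi D d'.
Proof.
move=> D0 /andP[d0 dd]; rewrite /chi; apply: lerD; apply: ler_wpM2r.
- by rewrite invr_ge0 mulr_ge0 ?ltW.
- by apply: lerXn2r; rewrite ?nnegrE //; lra.
- by rewrite invr_ge0 mulr_ge0 ?exprn_ge0 ?ltW.
- by apply: lerXn2r; rewrite ?nnegrE //; lra.
Qed.

(** chi(2, d) = d^2/8 + d^4/16 equals t/2 + t^2 at d = 2 sqrt t, the diameter of a circle of squared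
    radius t. *)
Lemma chi2_ge (R : realType) (t d : R) : 0 <= t -> 4 * t <= d ^+ 2 ->
  t / 2 + t ^+ 2 <= chi 2 d.
Proof.
move=> t0 h; rewrite /chi -[4%N]/(2 * 2)%N exprM; set x := d ^+ 2 in h *.
have : (4 * t) ^+ 2 <= x ^+ 2 by apply: lerXn2r; rewrite ?nnegrE //; lra.
have -> : x / (4 * 2) + x ^+ 2 / (2 * 2 ^+ 3) = x / 8 + x ^+ 2 / 16 by field.
lra.
Qed.

(** The lift of the segment is an arc of a great circle, so radial projection sends it to the chord
    AB. The vertices lie in the plane of normal A + B and height 1 + A.B, and t = |A - B|^2 / 4
    turns the last hypothesis of [radial_near] into an equality. *)
Lemma near_segment (R : realType) (n m : nat) (z : ept R) : in_hull (Seg n m) z ->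
  exists mu, is_weights mu /\ dist3 (isp z) (comb3 (Seg n m) mu) <= deltaQ (Seg n m).
Proof.
move=> [w [hw ->]]; set x := \sum_(i < 4) _; set y := \sum_(i < 4) _.
pose a : R := dy n m; pose b : R := dy n m.+1.
have a0 : 0 <= a by rewrite /a /dy divr_ge0 ?mulr_ge0 ?exprn_ge0.
have ab : a < b by rewrite /a /b /dy ltr_pM2r ?invr_gt0 ?exprn_gt0 // ltr_pM2l ?ltr_nat.
have y0 : y = 0 by rewrite /y big1 // => i _; rewrite /vertR; case: ifP; rewrite mulr0.
have x1 : a <= x <= b.
  apply/andP; split; [apply: weighted_sum_ge|apply: weighted_sum_le] => // i;
    rewrite /vertR; case: ifP => _ /=; rewrite -/a -/b; lra.
rewrite y0 {y y0}; move/andP: x1 => [ax xb].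
pose V i : v3 R := isp (vert (Seg n m) i).
pose A : v3 R := isp (Some (a, 0)); pose B : v3 R := isp (Some (b, 0)).
have ABE : dot3 A B = 2 * (1 + a * b) ^+ 2 / (sden (a, 0) * sden (b, 0)) - 1.
  rewrite /A /B !ispE /dot3 /=.
  have := sden_neq0 R (a, 0); have := sden_neq0 R (b, 0); rewrite /sden /= !expr0n !addr0 => h h'.
  by field; rewrite h h'.
have ab0 : 0 <= a * b by apply: mulr_ge0; lra.
(* A and B are not antipodal, because ab >= 0. *)
have AB1 : 0 < 1 + dot3 A B.
  rewrite ABE; have := sden_ge1 R (a, 0); have := sden_ge1 R (b, 0) => s1 s2.
  have : 0 < 2 * (1 + a * b) ^+ 2 / (sden (a, 0) * sden (b, 0)).
    by rewrite divr_gt0 ?mulr_gt0 ?exprn_gt0 //; lra.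
  lra.
pose i0 : 'I_4 := ord0; pose i1 : 'I_4 := inord 1.
have v0 : vertR (Seg n m) i0 = (a, 0) by [].
have v1 : vertR (Seg n m) i1 = (b, 0) by rewrite /vertR inordK.
have spec := @DQ_spec_antipodal R (Seg n m) ((a + b) / 2, 0) i0 i1.
have {}spec : DQ_spec (Seg n m) (DQ (Seg n m) : (R * R) * R).
  apply: spec; rewrite ?v0 ?v1 /=; [|lra|lra].
  move=> l; rewrite /vertR; case: ifP => // _; rewrite -/a -/b /dist2 /=.
  by congr Num.sqrt; field.
have d2 : dist3 A B <= d2Q (Seg n m).
  by apply: dist3_le_d2Q; rewrite -?v0 -?v1; case: spec => _ [->].
pose t := sqdist3 A B / 4.
have tE : t = (1 - dot3 A B) / 2 by rewrite /t sqdist3_unit ?isp_unit //; lra.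
have t0 : 0 <= t by rewrite divr_ge0 ?dot3_sq_ge0.
have [mu [hmu hd]] : exists mu, is_weights mu /\
    dist3 (isp (Some (x, 0))) (lin3 V mu) <= t / 2 + t ^+ 2.
  (* Coefficients on A and B of the lift of (x, 0), by Cramer's rule in the plane of the great
     circle. *)
  pose al := (b - x) * (1 + x * b) * sden (a, 0) / ((b - a) * (1 + a * b) * sden (x, 0)).
  pose be := (x - a) * (1 + x * a) * sden (b, 0) / ((b - a) * (1 + a * b) * sden (x, 0)).
  have s1 := sden_ge1 R (a, 0); have s2 := sden_ge1 R (b, 0); have s3 := sden_ge1 R (x, 0).
  have xb0 : 0 <= x * b by apply: mulr_ge0; lra.
  have xa0 : 0 <= x * a by apply: mulr_ge0; lra.
  have al0 : 0 <= al by rewrite /al divr_ge0 ?mulr_ge0 //; lra.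
  have be0 : 0 <= be by rewrite /be divr_ge0 ?mulr_ge0 //; lra.
  apply: (@radial_near R V _ (A.1.1 + B.1.1, A.1.2 + B.1.2, A.2 + B.2)
    (fun k => al * (k == i0)%:R + be * (k == i1)%:R + 0 * (k == i1)%:R) (1 + dot3 A B)) => //.
  - by move=> i; exact: isp_unit.
  - exact: isp_unit.
  - by move=> i; rewrite mul0r addr0 addr_ge0 // mulr_ge0.
  - rewrite lin3_triple !mul0r !addr0 /V /vert v0 v1 !ispE /= /al /be /sden /=.
    have h1 : b - a != 0 by rewrite subr_eq0 gt_eqF.
    have h2 : 1 + a * b != 0 by rewrite gt_eqF //; lra.
    have h3 := sden_neq0 R (a, 0); have h4 := sden_neq0 R (b, 0).
    have h5 := sden_neq0 R (x, 0); rewrite /sden /= !expr0n !addr0 in h3 h4 h5 *.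
    by congr (_, _, _); field; rewrite h1 h2 h3 h4 h5.
  - move=> i; have -> : dot3 (V i) (A.1.1 + B.1.1, A.1.2 + B.1.2, A.2 + B.2)
        = dot3 (V i) A + dot3 (V i) B by rewrite /dot3 /=; ring.
    have [->|->] : V i = A \/ V i = B.
      by rewrite /V /vert /vertR -/a -/b; case: ifP; [right|left].
    + by rewrite isp_unit.
    + by rewrite isp_unit addrC dot3C.
  - have -> : dot3 (A.1.1 + B.1.1, A.1.2 + B.1.2, A.2 + B.2) (A.1.1 + B.1.1, A.1.2 + B.1.2, A.2 + B.2)
      = dot3 A A + 2 * dot3 A B + dot3 B B by rewrite /dot3 /=; ring.
    rewrite !isp_unit tE; lra.
exists mu; split=> //; apply: (le_trans hd); apply: chi2_ge => //.
have : dist3 A B ^+ 2 <= d2Q (Seg n m) ^+ 2.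
  by apply: lerXn2r; rewrite ?nnegrE ?sqrtr_ge0 //; apply: le_trans d2; exact: sqrtr_ge0.
rewrite /dist3 sqr_sqrtr ?dot3_sq_ge0 // /t; lra.
Qed.

Lemma polar_direction (R : realType) (x y : R) : exists e : R * R,
  e.1 ^+ 2 + e.2 ^+ 2 = 1 /\ exists rho, x = rho * e.1 /\ y = rho * e.2.
Proof.
pose rho := Num.sqrt (x ^+ 2 + y ^+ 2).
have r2 : rho ^+ 2 = x ^+ 2 + y ^+ 2 by rewrite sqr_sqrtr // addr_ge0 ?sqr_ge0.
have [r0|r0] := eqVneq rho 0.
  (* At the origin every direction works. *)
  exists (1, 0); split=> /=; first by ring.
  exists 0; move: r2; rewrite r0 expr0n /= => /esym/eqP.
  rewrite paddr_eq0 ?sqr_ge0 // !sqrf_eq0 => /andP[/eqP-> /eqP->]; split; ring.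
exists (x / rho, y / rho); split=> /=.
  by rewrite !expr_div_n r2 -mulrDl divff // -r2 sqrf_eq0.
by exists rho; split; rewrite mulrC divfK.
Qed.

(* The two boundary points of the disk on the line through its centre and the origin
   lift to antipodal points of the boundary circle of the cap. *)
Lemma d2Q_ge_cap (R : realType) (c : cell) :
  let D : (R * R) * R := DQ c in
  let ka := D.1.1 ^+ 2 + D.1.2 ^+ 2 - D.2 ^+ 2 in
  0 <= D.2 -> 0 < 1 + ka ->
  4 * (4 * D.2 ^+ 2 / ((1 + ka) ^+ 2 + 4 * D.2 ^+ 2)) <= d2Q c ^+ 2.
Proof.
move=> D ka r0 ka0; set r := D.2 in ka r0 ka0 *.
have [e [e1 [rho [hx hy]]]] := polar_direction R D.1.1 D.1.2.
pose p : R * R := ((rho + r) * e.1, (rho + r) * e.2).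
pose q : R * R := ((rho - r) * e.1, (rho - r) * e.2).
have hp : dist2 p D.1 <= D.2.
  rewrite -ler_sqr ?nnegrE ?sqrtr_ge0 // dist2_sqr /= hx hy.
  have -> : ((rho + r) * e.1 - rho * e.1) ^+ 2 + ((rho + r) * e.2 - rho * e.2) ^+ 2
    = r ^+ 2 * (e.1 ^+ 2 + e.2 ^+ 2) by ring.
  by rewrite e1 mulr1.
have hq : dist2 q D.1 <= D.2.
  rewrite -ler_sqr ?nnegrE ?sqrtr_ge0 // dist2_sqr /= hx hy.
  have -> : ((rho - r) * e.1 - rho * e.1) ^+ 2 + ((rho - r) * e.2 - rho * e.2) ^+ 2
    = r ^+ 2 * (e.1 ^+ 2 + e.2 ^+ 2) by ring.
  by rewrite e1 mulr1.
have d2 := dist3_le_d2Q R c p q hp hq.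
have : dist3 (isp (Some p)) (isp (Some q)) ^+ 2 <= d2Q c ^+ 2.
  by apply: lerXn2r; rewrite ?nnegrE ?sqrtr_ge0 //; apply: le_trans d2; exact: sqrtr_ge0.
rewrite {1}/dist3 sqr_sqrtr ?dot3_sq_ge0 // sqdist3_isp; apply: le_trans.
have spE : sden p = 1 + (rho + r) ^+ 2.
  by transitivity (1 + (rho + r) ^+ 2 * (e.1 ^+ 2 + e.2 ^+ 2)); [rewrite /sden /=; ring|rewrite e1 mulr1].
have sqE : sden q = 1 + (rho - r) ^+ 2.
  by transitivity (1 + (rho - r) ^+ 2 * (e.1 ^+ 2 + e.2 ^+ 2)); [rewrite /sden /=; ring|rewrite e1 mulr1].
have -> : (p.1 - q.1) ^+ 2 + (p.2 - q.2) ^+ 2 = 4 * r ^+ 2.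
  by transitivity (4 * r ^+ 2 * (e.1 ^+ 2 + e.2 ^+ 2)); [rewrite /=; ring|rewrite e1 mulr1].
have kaE : ka = rho ^+ 2 - r ^+ 2.
  by transitivity (rho ^+ 2 * (e.1 ^+ 2 + e.2 ^+ 2) - r ^+ 2); [rewrite /ka hx hy; ring|rewrite e1 mulr1].
rewrite le_eqVlt [4 * (_ / _)]mulrA; apply/orP; left; apply/eqP; congr (_ / _).
by rewrite spE sqE kaE; ring.
Qed.

Lemma exists_lin3_triple (R : realType) (V : 'I_4 -> v3 R) (P : v3 R) (i j l : 'I_4) :
  (exists a b c, [/\ 0 <= a, 0 <= b, 0 <= c & P =
    (a * (V i).1.1 + b * (V j).1.1 + c * (V l).1.1,
     a * (V i).1.2 + b * (V j).1.2 + c * (V l).1.2,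
     a * (V i).2 + b * (V j).2 + c * (V l).2)]) ->
  exists al, (forall k, 0 <= al k) /\ P = lin3 V al.
Proof.
move=> [a [b [c [a0 b0 c0 ->]]]].
exists (fun k => a * (k == i)%:R + b * (k == j)%:R + c * (k == l)%:R).
by split; [move=> k; rewrite !addr_ge0 ?mulr_ge0|rewrite lin3_triple].
Qed.

(** The bounds of a good square enter here: the edge has length l <= 1/2 and unit direction [e], and
    its line is at distance |m| <= 3/2 from the origin, so m^2 <= 3. *)
Lemma frame_edge_near (R : realType) (p q z e : R * R) (l : R) :
  e.1 ^+ 2 + e.2 ^+ 2 = 1 -> q.1 = p.1 + l * e.1 -> q.2 = p.2 + l * e.2 ->
  0 < l <= 1 / 2 -> - (3 / 2) <= p.1 * e.2 - p.2 * e.1 <= 3 / 2 ->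
  0 <= (z.1 - p.1) * e.1 + (z.2 - p.2) * e.2 <= l ->
  0 <= e.1 * (z.2 - p.2) - e.2 * (z.1 - p.1) <= l ->
  0 < det_lift p q z ->
  let A := isp (Some p) in let B := isp (Some q) in
  exists th, 0 <= th <= 1 /\
    dist3 (isp (Some z))
      ((1 - th) * A.1.1 + th * B.1.1, (1 - th) * A.1.2 + th * B.1.2,
       (1 - th) * A.2 + th * B.2) <= chi 1 (dist3 A B).
Proof.
move=> e1 q1 q2 /andP[l0 l1] /andP[m0 m1] /andP[s0 s1] /andP[t0 t1] D0.
set m := p.1 * e.2 - p.2 * e.1 in m0 m1; set s := _ + _ in s0 s1; set t := _ - _ in t0 t1.
have u1 : q.1 - p.1 = l * e.1 by rewrite q1; ring.
have u2 : q.2 - p.2 = l * e.2 by rewrite q2; ring.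
have lE : (q.1 - p.1) ^+ 2 + (q.2 - p.2) ^+ 2 = l ^+ 2.
  by transitivity (l ^+ 2 * (e.1 ^+ 2 + e.2 ^+ 2)); [rewrite u1 u2; ring|rewrite e1 mulr1].
have gE : p.1 * q.2 - p.2 * q.1 = m * l by rewrite q1 q2 /m; ring.
have crE : (q.1 - p.1) * (z.2 - p.2) - (q.2 - p.2) * (z.1 - p.1) = t * l.
  by rewrite u1 u2 /t; ring.
have wE : (z.1 - p.1) * (q.1 - p.1) + (z.2 - p.2) * (q.2 - p.2) = s * l.
  by rewrite u1 u2 /s; ring.
have wE' : (q.1 - z.1) * (q.1 - p.1) + (q.2 - z.2) * (q.2 - p.2) = (l - s) * l.
  transitivity ((q.1 - p.1) ^+ 2 + (q.2 - p.2) ^+ 2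
     - ((z.1 - p.1) * (q.1 - p.1) + (z.2 - p.2) * (q.2 - p.2))); first by ring.
  by rewrite lE wE; ring.
(* p.q is the squared norm of the midpoint minus l^2/4, hence at least -1/16; thus m l <= 3/4 stays
   below 1 + p.q. *)
have pqE : p.1 * q.1 + p.2 * q.2 = m ^+ 2 + (p.1 * e.1 + p.2 * e.2 + l / 2) ^+ 2 - l ^+ 2 / 4.
  transitivity ((p.1 ^+ 2 + p.2 ^+ 2) * (e.1 ^+ 2 + e.2 ^+ 2) + l * (p.1 * e.1 + p.2 * e.2)).
    by rewrite e1 q1 q2; ring.
  by rewrite /m; field.
have l2 : l ^+ 2 <= 1 / 4 by have := mulr_ge0 (_ : 0 <= 1 / 2 - l) (_ : 0 <= 1 / 2 + l); lra.
have pq0 : - (1 / 16) <= p.1 * q.1 + p.2 * q.2.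
  by rewrite pqE; have := sqr_ge0 m; have := sqr_ge0 (p.1 * e.1 + p.2 * e.2 + l / 2); lra.
have ml : m * l <= 3 / 4 by have := mulr_ge0 (_ : 0 <= 3 / 2 - m) (ltW l0); lra.
have m2 : m ^+ 2 <= 3 by have := mulr_ge0 (_ : 0 <= 3 / 2 - m) (_ : 0 <= 3 / 2 + m); lra.
apply: lift_edge_near; rewrite /= ?lE ?gE ?crE ?wE ?wE' //.
- by rewrite exprn_gt0.
- by rewrite expr2 !pmulr_lge0 // ler_pM2r // t0.
- lra.
- lra.
- by rewrite exprMn; apply: ler_wpM2r => //; exact: sqr_ge0.
- by rewrite mulr_ge0 // ltW.
- by rewrite mulr_ge0 ?subr_ge0 // ltW.
Qed.

(** A positive determinant for one of the four edges puts the lift of z in the lune over that edge,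
    and the edge bound applies. If none is positive, the lift lies in the cone over the lifted
    vertices, and the cap bound applies. *)
Lemma near_square (R : realType) (n a b : nat) (z : ept R) :
  valid_cell R (Sq n a b) -> in_hull (Sq n a b) z ->
  exists mu, is_weights mu /\ dist3 (isp z) (comb3 (Sq n a b) mu) <= deltaQ (Sq n a b).
Proof.
set c := Sq n a b.
move=> [_ [_ [hx0 [hx1 [hy0 [hy1 hl]]]]]] [w [hw ->]] {z}.
set zx := \sum_(i < 4) _; set zy := \sum_(i < 4) _.
pose l : R := dy n 1.
have dyS (m : nat) : dy n m.+1 = dy n m + l :> R.
  by rewrite /l /dy -mulrDl -mulrDr -natrD addn1.
have l0 : 0 < l by rewrite /l /dy divr_gt0 ?mulr_gt0 ?exprn_gt0.
pose x0 : R := -2 + dy n a; pose y0 : R := -2 + dy n b.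
pose x1 : R := -2 + dy n a.+1; pose y1 : R := -2 + dy n b.+1.
have x1E : x1 = x0 + l by rewrite /x1 /x0 dyS; ring.
have y1E : y1 = y0 + l by rewrite /y1 /y0 dyS; ring.
rewrite -/x0 -/x1 -/y0 -/y1 -/l in hx0 hx1 hy0 hy1 hl.
pose i0 : 'I_4 := ord0; pose i1 : 'I_4 := inord 1.
pose i2 : 'I_4 := inord 2; pose i3 : 'I_4 := inord 3.
have v0 : vertR c i0 = (x0, y0) by [].
have v1 : vertR c i1 = (x1, y0) by rewrite /vertR /= inordK.
have v2 : vertR c i2 = (x1, y1) by rewrite /vertR /= inordK.
have v3' : vertR c i3 = (x0, y1) by rewrite /vertR /= inordK.
have vP i : [\/ vertR c i = (x0, y0), vertR c i = (x1, y0), vertR c i = (x1, y1)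
              | vertR c i = (x0, y1)].
  rewrite /vertR /c -/x0 -/y0 -/x1 -/y1; case: i => [[|[|[|[|i]]]] hi] //=.
  - by constructor 1.
  - by constructor 2.
  - by constructor 3.
  - by constructor 4.
have zxP : x0 <= zx <= x1.
  apply/andP; split; [apply: weighted_sum_ge|apply: weighted_sum_le] => // i;
    case: (vP i) => -> /=; lra.
have zyP : y0 <= zy <= y1.
  apply/andP; split; [apply: weighted_sum_ge|apply: weighted_sum_le] => // i;
    case: (vP i) => -> /=; lra.
clearbody zx zy l x0 x1 y0 y1; subst x1 y1.
move: zxP zyP => /andP[zx0 zx1] /andP[zy0 zy1].
have l2 : l ^+ 2 <= 1 / 4.
  by have := lerXn2r 2 (_ : l \is Num.nneg) (_ : 1 / 2 \is Num.nneg) hl; rewrite !nnegrE; lra.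
have l20 : 0 < l ^+ 2 by rewrite exprn_gt0.
have xx : - (1 / 16) <= x0 * (x0 + l) by have := sqr_ge0 (x0 + l / 2); lra.
have yy : - (1 / 16) <= y0 * (y0 + l) by have := sqr_ge0 (y0 + l / 2); lra.
pose z : R * R := (zx, zy); pose V i : v3 R := isp (vert c i).
have edge i j : (exists mu : 'I_4 -> R, is_weights mu /\
    dist3 (isp (Some z)) (lin3 V mu) <= chi 1 (dist3 (V i) (V j))) ->
    j = inZp i.+1 ->
    exists mu, is_weights mu /\ dist3 (isp (Some z)) (comb3 c mu) <= deltaQ c.
  move=> [mu [h1 h2]] jE; exists mu; split=> //; apply: (le_trans h2); rewrite {}jE.
  rewrite /deltaQ le_max; apply/orP; left; apply: chi_le => //.
  rewrite sqrtr_ge0 /=; exact: (le_bigmax _ (fun i => dist3 (V i) (V (inZp i.+1))) i).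
have nE i j : (exists th, 0 <= th <= 1 /\ dist3 (isp (Some z))
      ((1 - th) * (V i).1.1 + th * (V j).1.1, (1 - th) * (V i).1.2 + th * (V j).1.2,
       (1 - th) * (V i).2 + th * (V j).2) <= chi 1 (dist3 (V i) (V j))) ->
    exists mu : 'I_4 -> R, is_weights mu /\
      dist3 (isp (Some z)) (lin3 V mu) <= chi 1 (dist3 (V i) (V j)).
  move=> [th [th0 h]]; have [mu [h1 h2]] := exists_weights_segment R V i j th th0.
  by exists mu; rewrite h2.
have [D01|D01] := ltP 0 (det_lift (x0, y0) (x0 + l, y0) z).
  apply: (edge i0 i1); last by apply: val_inj; rewrite /= inordK.
  by apply: nE; rewrite /V /vert v0 v1; apply: (@frame_edge_near R _ _ z (1, 0) l) => //=; lra.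
have [D12|D12] := ltP 0 (det_lift (x0 + l, y0) (x0 + l, y0 + l) z).
  apply: (edge i1 i2); last by apply: val_inj; rewrite /= !inordK.
  by apply: nE; rewrite /V /vert v1 v2; apply: (@frame_edge_near R _ _ z (0, 1) l) => //=; lra.
have [D23|D23] := ltP 0 (det_lift (x0 + l, y0 + l) (x0, y0 + l) z).
  apply: (edge i2 i3); last by apply: val_inj; rewrite /= !inordK.
  by apply: nE; rewrite /V /vert v2 v3'; apply: (@frame_edge_near R _ _ z (-1, 0) l) => //=; lra.
have [D30|D30] := ltP 0 (det_lift (x0, y0 + l) (x0, y0) z).
  apply: (edge i3 i0); last by apply: val_inj; rewrite /= !inordK.
  by apply: nE; rewrite /V /vert v3' v0; apply: (@frame_edge_near R _ _ z (0, -1) l) => //=; lra.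
(* Up to the factor -4, this is [det_lift] of each of the triangles 012 and 023 into which a
   diagonal cuts the square. *)
have kap : 0 < l ^+ 2 * (1 + x0 * (x0 + l) + y0 * (y0 + l)) by apply: mulr_gt0 => //; lra.
have [al [al0 alE]] : exists al, (forall k, 0 <= al k) /\ isp (Some z) = lin3 V al.
  (* The great circle through the lifted vertices 2 and 0 decides which triangle contains the
     projection. *)
  have [D20|D02] := leP (det_lift (x0 + l, y0 + l) (x0, y0) z) 0.
    apply: (exists_lin3_triple _ V _ i0 i1 i2); rewrite /V /vert v0 v1 v2.
    by apply: lift_in_triangle => //; rewrite /det_lift /=; lra.
  apply: (exists_lin3_triple _ V _ i0 i2 i3); rewrite /V /vert v0 v2 v3'.
  by apply: lift_in_triangle => //; move: D02; rewrite /det_lift /=; lra.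
have spec : DQ_spec c (DQ c : (R * R) * R).
  apply: (@DQ_spec_antipodal R c (x0 + l / 2, y0 + l / 2) i0 i2); rewrite ?v0 ?v2;
    [|by rewrite /=; lra|by rewrite /=; lra].
  by move=> k; rewrite /dist2; congr Num.sqrt; case: (vP k) => -> /=; field.
set D : (R * R) * R := DQ c in spec.
case: spec => r0 [hD _].
have hD2 i : ((vertR c i).1 - D.1.1) ^+ 2 + ((vertR c i).2 - D.1.2) ^+ 2 = D.2 ^+ 2.
  by rewrite -dist2_sqr hD.
pose ka := D.1.1 ^+ 2 + D.1.2 ^+ 2 - D.2 ^+ 2.
(* [DQ] is known only through its specification; the circle equations at three vertices determine
   its centre. Then 1 + ka is the second factor in [kap]. *)
have ka0 : 0 < 1 + ka.
  have := hD2 i0; have := hD2 i1; have := hD2 i3; rewrite v0 v1 v3' /= => e3 e1 e0.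
  have cx : D.1.1 = x0 + l / 2 by apply: (mulfI (lt0r_neq0 l0)); lra.
  have cy : D.1.2 = y0 + l / 2 by apply: (mulfI (lt0r_neq0 l0)); lra.
  by rewrite /ka; move: e0; rewrite cx cy; lra.
have dn0 : 0 < (1 + ka) ^+ 2 + 4 * D.2 ^+ 2.
  by rewrite ltr_pwDl ?exprn_gt0 // mulr_ge0 ?sqr_ge0.
(* The squared radius of the circle bounding the cap: its plane is n.x = 1 + ka with n = (2 D.1, ka
   - 1), and |n|^2 is the denominator. *)
pose t := 4 * D.2 ^+ 2 / ((1 + ka) ^+ 2 + 4 * D.2 ^+ 2).
have t0 : 0 <= t by rewrite divr_ge0 ?mulr_ge0 ?sqr_ge0 // ltW.
have [mu [hmu hd]] : exists mu, is_weights mu /\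
    dist3 (isp (Some z)) (lin3 V mu) <= t / 2 + t ^+ 2.
  apply: (@radial_near R V _ (2 * D.1.1, 2 * D.1.2, ka - 1) al (1 + ka)) => //.
  - by move=> i; exact: isp_unit.
  - exact: isp_unit.
  - move=> i; have := hD2 i; rewrite /V /vert ispE; set p := vertR c i => e.
    have e' : D.2 ^+ 2 = (p.1 - D.1.1) ^+ 2 + (p.2 - D.1.2) ^+ 2 by [].
    have h := sden_neq0 R p; rewrite /sden in h.
    by rewrite /ka e' /dot3 /sden /=; field.
  - have -> : dot3 (2 * D.1.1, 2 * D.1.2, ka - 1) (2 * D.1.1, 2 * D.1.2, ka - 1)
      = (1 + ka) ^+ 2 + 4 * D.2 ^+ 2 by rewrite /dot3 /ka /=; ring.
    rewrite /t mulrBl mul1r divfK ?gt_eqF //; lra.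
exists mu; split=> //; apply: (le_trans hd); rewrite /deltaQ le_max; apply/orP; right.
by apply: chi2_ge => //; exact: d2Q_ge_cap.
Qed.

Lemma near_hull (R : realType) (c : cell) (z : ept R) : valid_cell R c -> in_hull c z ->
  exists mu, is_weights mu /\ dist3 (isp z) (comb3 c mu) <= deltaQ c.
Proof.
case: c => [n m|n i j|].
- by move=> _; exact: near_segment.
- exact: near_square.
- move=> _ /= ->.
  have [mu [hmu hE]] := @exists_weights_segment R (fun=> isp None) ord0 ord0 0
    ltac:(by rewrite lexx ler01).
  exists mu; split=> //; rewrite -[comb3 _ _]/(lin3 (fun=> isp None) mu) hE.
  by apply: dist3_le => //=; rewrite /sqdist3 /dot3 /sub3 /=; lra.
Qed.

Lemma weighting_system_near (R : realType) (lam : cell -> ept R -> 'I_4 -> R) (c : cell) (z : ept R) :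
  weighting_system lam -> valid_cell R c -> in_hull c z ->
  is_weights (lam c z) /\ dist3 (isp z) (comb3 c (lam c z)) <= deltaQ c.
Proof.
move=> hlam vc hz; have [hw hmin] := hlam c vc z hz; split=> //.
have [mu [hmu hd]] := near_hull _ _ _ vc hz.
by apply: le_trans hd; apply: hmin; exists mu.
Qed.

Lemma deltaQ_ge0 (R : realType) (c : cell) : 0 <= deltaQ c :> R.
Proof. by case: c => //= *; rewrite ?le_max ?chi_ge0. Qed.

(** This lets a vertex stand for one point of a pair while the other point is averaged. *)
Lemma vert_in_hull (R : realType) (c : cell) (i : 'I_4) : in_hull c (vert c i : ept R).
Proof.
have [mu [[mu0 mu1] E]] : exists mu : 'I_4 -> R, is_weights mu /\
    forall f : 'I_4 -> R, \sum_(k < 4) mu k * f k = f i.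
  exists (fun k => (k == i)%:R); split; last by move=> f; exact: sum_delta.
  split=> [k|]; first exact: ler0n.
  by have := sum_delta R 4 i (fun=> 1); under eq_bigr do rewrite mulr1.
by case: c => [n m|n a b|] //; exists mu; split=> //;
  rewrite (E (fun k => (vertR _ k).1)) (E (fun k => (vertR _ k).2)) -surjective_pairing.
Qed.

Lemma dot3_comb3 (R : realType) (c : cell) (mu : 'I_4 -> R) (w : v3 R) :
  dot3 (comb3 c mu) w = \sum_(i < 4) mu i * dot3 (isp (vert c i)) w.
Proof. exact: (dot3_lin3 _ (fun i => isp (vert c i))). Qed.

Lemma hullS_norm_le1 (R : realType) (c : cell) (w : v3 R) : hullS c w -> dot3 w w <= 1.
Proof.
move=> [mu [hmu ->]]; rewrite dot3_comb3; apply: weighted_sum_le => // i.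
rewrite dot3C dot3_comb3; apply: weighted_sum_le => // j.
by have /andP[] := dot3_unit_bound R _ _ (isp_unit R (vert c j)) (isp_unit R (vert c i)).
Qed.

Lemma dist3_vert_le_dQ (R : realType) (c : cell) (i j : 'I_4) : c <> Inf ->
  dist3 (isp (vert c i)) (isp (vert c j)) <= dQ c :> R.
Proof.
have inS k : hullS c (isp (vert c k) : v3 R).
  have [mu [hmu E]] := @exists_weights_segment R (fun i => isp (vert c i)) k k 0
    ltac:(by rewrite lexx ler01).
  exists mu; split=> //; rewrite -[comb3 _ _]/(lin3 (fun i => isp (vert c i)) mu) E.
  by rewrite !subr0 !mul1r !mul0r !addr0; case: (isp _) => [[]].
by case: c inS => // *; apply: diam_ge => //; exact: hullS_norm_le1.
Qed.

(** This makes T an upper bound of u at all vertices. The lift of z is within delta(Q') of a hull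
    point, whose product with a vertex is at most [maxdot]; the remaining terms of [dotmax] are
    nonnegative. *)
Lemma dot3_vert_le_dotmax (R : realType) (c c' : cell) (z : ept R) (i : 'I_4) :
  c <> Inf -> valid_cell R c' -> in_hull c' z ->
  dot3 (isp (vert c i)) (isp z) <= dotmax c c'.
Proof.
move=> cI vc hz.
have [c'I|c'I] : c' = Inf \/ c' <> Inf by case: c' {vc hz} => *; [right|right|left].
  rewrite c'I /= in hz *; rewrite hz; case: c cI => // *;
  exact: (le_bigmax _ (fun i => dot3 (isp (vert _ i)) (0, 0, 1)) i).
have [mu [hmu hd]] := near_hull _ _ _ vc hz.
have h1 : dot3 (isp (vert c i)) (comb3 c' mu) <= maxdot c c'.
  rewrite dot3C dot3_comb3; apply: weighted_sum_le => // j; rewrite dot3C.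
  apply: le_trans (le_bigmax _ _ i).
  exact: (le_bigmax _ (fun j => dot3 (isp (vert c i)) (isp (vert c' j))) j).
have h2 := dot3_le_dist3 R (isp z) (comb3 c' mu) _ (isp_unit R (vert c i)).
rewrite !(dot3C _ _ (isp (vert c i))) in h2.
have d0 := deltaQ_ge0 R c; have d0' := deltaQ_ge0 R c'; have dd := mulr_ge0 d0 d0'.
have -> : dotmax c c' = maxdot c c' + deltaQ c + deltaQ c' + deltaQ c * deltaQ c' :> R.
  by case: c cI {h1 h2 d0 dd} => //; case: c' c'I {vc hz hd d0'}.
lra.
Qed.

(** * Averaging the energy *)

(* Popoviciu's inequality, from 0 <= (max u - u i) (u i - min u). *)
Lemma variance_le (R : realType) (mu u : 'I_4 -> R) (d : R) : is_weights mu ->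
  (forall i j, u i - u j <= 2 * d) ->
  \sum_(i < 4) mu i * (u i - \sum_(j < 4) mu j * u j) ^+ 2 <= d ^+ 2.
Proof.
move=> hmu hu; have [mu0 mu1] := hmu; set m := \sum_(j < 4) mu j * u j.
have [i1 _ h1] := @arg_maxP _ _ _ (ord0 : 'I_4) xpredT u isT.
have [i2 _ h2] := @arg_minP _ _ _ (ord0 : 'I_4) xpredT u isT.
have mE : \sum_(j < 4) mu j * u j = m by [].
clearbody m.
have e1 : \sum_(i < 4) mu i * ((u i1 - u i) * (u i - u i2)) =
   (u i1 - m) * (m - u i2) - \sum_(i < 4) mu i * (u i - m) ^+ 2.
  have -> : (u i1 - m) * (m - u i2) =
     (u i1 + u i2 - 2 * m) * \sum_(i < 4) mu i * u i + (m ^+ 2 - u i1 * u i2) * \sum_(i < 4) mu i.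
    by rewrite mu1 mE; ring.
  rewrite !mulr_sumr -big_split -sumrB /=; apply: eq_bigr => i _; ring.
have e2 : 0 <= \sum_(i < 4) mu i * ((u i1 - u i) * (u i - u i2)).
  apply: sumr_ge0 => i _; rewrite mulr_ge0 // mulr_ge0 // subr_ge0; [exact: h1|exact: h2].
have e3 : (u i1 - u i2) ^+ 2 <= (2 * d) ^+ 2.
  have r0 : 0 <= u i1 - u i2 by rewrite subr_ge0; exact: h1.
  by apply: lerXn2r; rewrite ?nnegrE //; apply: le_trans (hu i1 i2).
have := sqr_ge0 (u i1 + u i2 - 2 * m); move: e2; rewrite e1; lra.
Qed.

(** Taylor's formula at the mean [m] is averaged: the linear terms cancel, and the quadratic ones
    give [C] times the variance. *)
Lemma powR_jensen_gap (R : realType) (k d T : R) (mu u : 'I_4 -> R) : 2 <= k ->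
  is_weights mu -> (forall i, 0 <= u i <= T) -> (forall i j, u i - u j <= 2 * d) ->
  \sum_(i < 4) mu i * u i `^ k <= (\sum_(i < 4) mu i * u i) `^ k
     + 1 / 2 * k * (k - 1) * T `^ (k - 2) * d ^+ 2.
Proof.
move=> k2 hmu hu hd; have [mu0 mu1] := hmu; set m := \sum_(i < 4) mu i * u i.
have m0 : 0 <= m <= T.
  apply/andP; split; [apply: weighted_sum_ge|apply: weighted_sum_le] => // i;
  by have /andP[] := hu i.
set C := 1 / 2 * k * (k - 1) * T `^ (k - 2).
have C0 : 0 <= C by rewrite !mulr_ge0 ?powR_ge0 //; lra.
have := ler_wpM2l C0 (variance_le _ _ _ _ hmu hd); rewrite -/m => hV.
apply: le_trans (lerD (lexx _) hV).
have mE : \sum_(i < 4) mu i * u i = m by [].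
clearbody m.
(* The vanishing linear term is added so that the two sums compare term by term. *)
have -> : m `^ k = m `^ k * \sum_(i < 4) mu i
    + k * m `^ (k - 1) * (\sum_(i < 4) mu i * u i - m * \sum_(i < 4) mu i).
  by rewrite mu1 mE; ring.
rewrite !mulr_sumr -sumrB mulr_sumr -!big_split /=; apply: ler_sum => i _.
have := ler_wpM2l (mu0 i) (powR_le_taylor2 R k (u i) m T k2 (hu i) m0); rewrite -/C; lra.
Qed.

Lemma GkE (R : realType) (k : R) (p q : ept R) :
  Gk k p q = (2 + 2 * dot3 (isp p) (isp q)) `^ k.
Proof. by rewrite /Gk sqdist3_unit ?isp_unit //; congr (_ `^ _); lra. Qed.

Lemma Gk_sym (R : realType) (k : R) (p q : ept R) : Gk k p q = Gk k q p.
Proof. by rewrite !GkE dot3C. Qed.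

(** The values [u] at the vertices differ by at most 2 d(Q), which gives the first term of epsilon.
    Their mean [us] is at most T and exceeds [v] by at most 2 delta(Q), so the tangent at [us] gives
    the second. *)
Lemma Gk_ge_average (R : realType) (k : R) (lam : cell -> ept R -> 'I_4 -> R)
    (c c' : cell) (z z' : ept R) : 2 <= k -> weighting_system lam ->
  valid_cell R c -> valid_cell R c' -> in_hull c z -> in_hull c' z' ->
  \sum_(i < 4) lam c z i * Gk k (vert c i) z' - epsQ k c c' <= Gk k z z'.
Proof.
move=> k2 hlam vc vc' hz hz'.
have [hw hd] := weighting_system_near _ _ _ _ hlam vc hz; have [w0 w1] := hw.
have [cI|cI] : c = Inf \/ c <> Inf by case: c {vc hz hw hd w0 w1} => *; [right|right|left].
  rewrite cI /= in hz w1 *; rewrite hz in w1 *.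
  by rewrite subr0 -mulr_suml w1 mul1r.
pose T : R := 2 + 2 * dotmax c c'.
have -> : epsQ k c c' = 1 / 2 * k * (k - 1) * T `^ (k - 2) * dQ c ^+ 2
    + 2 * k * T `^ (k - 1) * deltaQ c.
  by rewrite /T; case: c cI {hz vc hw hd w0 w1 T}.
pose u i := 2 + 2 * dot3 (isp (vert c i)) (isp z').
have hu i : 0 <= u i <= T.
  have := dot3_vert_le_dotmax R c c' z' i cI vc' hz'.
  have /andP[] := dot3_unit_bound R _ _ (isp_unit R (vert c i)) (isp_unit R z').
  rewrite /u /T; lra.
have hud i j : u i - u j <= 2 * dQ c.
  have := dot3_le_dist3 R (isp (vert c i)) (isp (vert c j)) _ (isp_unit R z').
  have := dist3_vert_le_dQ R c i j cI; rewrite /u; lra.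
have := powR_jensen_gap R k (dQ c) T (lam c z) u k2 hw hu hud.
set us := \sum_(i < 4) lam c z i * u i.
have usE : us = 2 + 2 * dot3 (comb3 c (lam c z)) (isp z').
  rewrite dot3_comb3; transitivity (2 * \sum_(i < 4) lam c z i
    + 2 * \sum_(i < 4) lam c z i * dot3 (isp (vert c i)) (isp z')); last by rewrite w1 mulr1.
  by rewrite !mulr_sumr -big_split /=; apply: eq_bigr => i _; rewrite /u; ring.
have us0 : 0 <= us <= T.
  apply/andP; split; [apply: weighted_sum_ge|apply: weighted_sum_le] => // i;
  by have /andP[] := hu i.
pose v := 2 + 2 * dot3 (isp z) (isp z').
have v0 : 0 <= v.
  have /andP[] := dot3_unit_bound R _ _ (isp_unit R z) (isp_unit R z'); rewrite /v; lra.
have dz : us - v <= 2 * deltaQ c.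
  have := dot3_le_dist3 R (comb3 c (lam c z)) (isp z) _ (isp_unit R z').
  have -> : dist3 (comb3 c (lam c z)) (isp z) = dist3 (isp z) (comb3 c (lam c z)).
    by congr Num.sqrt; rewrite /sqdist3 /dot3 /sub3 /=; ring.
  rewrite usE /v; lra.
have us1 : 0 <= us by case/andP: us0.
have tan := powR_tangent_le R k us v ltac:(lra) us1 v0.
have h1 : k * us `^ (k - 1) * (us - v) <= k * T `^ (k - 1) * (2 * deltaQ c).
  apply: (@le_trans _ _ (k * us `^ (k - 1) * (2 * deltaQ c))).
    by apply: ler_wpM2l => //; rewrite mulr_ge0 ?powR_ge0 //; lra.
  apply: ler_wpM2r; first by rewrite mulr_ge0 ?deltaQ_ge0.
  by apply: ler_wpM2l; [lra|apply: ge0_ler_powR; rewrite ?nnegrE; lra].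
have -> : \sum_(i < 4) lam c z i * Gk k (vert c i) z' = \sum_(i < 4) lam c z i * u i `^ k.
  by apply: eq_bigr => i _; rewrite GkE.
rewrite (GkE _ _ z) -/v; lra.
Qed.

(** First z is averaged with z' fixed, then z' with each vertex of [c] fixed; the second error does
    not depend on that vertex, and the weights sum to 1. *)
Lemma Gk_ge_average2 (R : realType) (k : R) (lam : cell -> ept R -> 'I_4 -> R)
    (c c' : cell) (z z' : ept R) : 2 <= k -> weighting_system lam ->
  valid_cell R c -> valid_cell R c' -> in_hull c z -> in_hull c' z' ->
  \sum_(i < 4) \sum_(j < 4) lam c z i * lam c' z' j * Gk k (vert c i) (vert c' j)
    - (epsQ k c c' + epsQ k c' c) <= Gk k z z'.
Proof.
move=> k2 hlam vc vc' hz hz'.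
have [[w0 w1] _] := hlam c vc z hz.
apply: le_trans (Gk_ge_average R k lam c c' z z' k2 hlam vc vc' hz hz').
rewrite opprD addrA addrAC lerD2r -[X in _ - X]mul1r -w1 mulr_suml -sumrB.
apply: ler_sum => i _; rewrite Gk_sym.
have := Gk_ge_average R k lam c' c z' (vert c i) k2 hlam vc' vc hz' (vert_in_hull R c i).
move=> /(ler_wpM2l (w0 i)); apply: le_trans.
rewrite mulrBr lerD2r mulr_sumr; apply: ler_sum => j _.
by rewrite mulrA Gk_sym.
Qed.

(** Expanding f in indicators and absorbing them into the factors at a and b ([L']) leaves a sum of
    products, which factors; every factor away from a and b is 1. *)
Lemma sum_ffun_marginal2 (R : realType) (N : nat) (L : 'I_N -> 'I_4 -> R) (a b : 'I_N)
    (f : 'I_4 -> 'I_4 -> R) : (forall c, \sum_(i < 4) L c i = 1) -> a != b ->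
  \sum_(I : {ffun 'I_N -> 'I_4}) (\prod_(c < N) L c (I c)) * f (I a) (I b) =
  \sum_(i < 4) \sum_(j < 4) L a i * L b j * f i j.
Proof.
move=> L1 ab.
have fE (I : {ffun 'I_N -> 'I_4}) : f (I a) (I b) =
    \sum_(i < 4) \sum_(j < 4) (I a == i)%:R * (I b == j)%:R * f i j.
  rewrite -(sum_delta R 4 (I a) (fun i => f i (I b))); apply: eq_bigr => i _.
  rewrite -(sum_delta R 4 (I b) (f i)) mulr_sumr; apply: eq_bigr => j _.
  by rewrite mulrA [i == _]eq_sym [j == _]eq_sym.
under eq_bigr do rewrite fE mulr_sumr; rewrite exchange_big; apply: eq_bigr => i _.
under eq_bigr do rewrite mulr_sumr; rewrite exchange_big; apply: eq_bigr => j _ /=.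
under eq_bigr do rewrite mulrA; rewrite -mulr_suml; congr (_ * _).
pose L' c x := L c x * (if c == a then (x == i)%:R else if c == b then (x == j)%:R else 1).
transitivity (\sum_(I : {ffun 'I_N -> 'I_4}) \prod_(c < N) L' c (I c)).
  apply: eq_bigr => I _; rewrite /L' big_split /=; congr (_ * _).
  rewrite (bigD1 a) //= eqxx (bigD1 b) ?(eq_sym b) //= eq_sym (negPf ab) eqxx big1 ?mulr1 //.
  by move=> c /andP[/negPf -> /negPf ->].
have rest : \prod_(c < N | (c != a) && (c != b)) \sum_(x < 4) L' c x = 1.
  apply: big1 => c /andP[/negPf ca /negPf cb]; rewrite -[RHS](L1 c); apply: eq_bigr => x _.
  by rewrite /L' ca cb mulr1.
rewrite -bigA_distr_bigA (bigD1 a) //= (bigD1 b) ?(eq_sym b) //= rest mulr1.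
rewrite /L' eqxx [b == a]eq_sym (negPf ab) eqxx.
by congr (_ * _); under eq_bigr do rewrite mulrC; rewrite sum_delta.
Qed.

(** Each unordered pair collects both of its errors, as in [Gk_ge_average2]. *)
Lemma sum_neq_split (R : realType) (n : nat) (F : 'I_n -> 'I_n -> R) :
  \sum_(i < n) \sum_(j < n | j != i) F i j =
  \sum_(a < n) \sum_(b < n | (a < b)%N) (F a b + F b a).
Proof.
under [RHS]eq_bigr do rewrite big_split /=; rewrite big_split /=.
rewrite [X in _ = _ + X](exchange_big_dep xpredT) //= -big_split /=; apply: eq_bigr => i _.
rewrite (bigID (fun j : 'I_n => (i < j)%N)) /=; congr (_ + _); apply: eq_bigl => j;
  rewrite -val_eqE /=; lia.
Qed.

Theorem theorem4p7 (R : realType) (k : R) (N : nat) (Q : 'I_N.+1 -> cell)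
    (lam : cell -> ept R -> 'I_4 -> R) (z : 'I_N.+1 -> ept R) :
  2 <= k -> (1 <= N)%N ->
  (forall i, valid_cell R (Q i)) ->
  weighting_system lam ->
  (forall i, in_hull (Q i) (z i)) ->
  \sum_(I : {ffun 'I_N.+1 -> 'I_4})
      (\prod_(a < N.+1) lam (Q a) (z a) (I a)) * energyI k Q I
    - \sum_(i < N.+1) \sum_(j < N.+1 | j != i) epsQ k (Q i) (Q j)
  <= \sum_(a < N.+1) \sum_(b < N.+1 | (a < b)%N) Gk k (z a) (z b).
Proof.
move=> k2 _ vQ hlam hz.
have -> : \sum_(I : {ffun 'I_N.+1 -> 'I_4})
      (\prod_(a < N.+1) lam (Q a) (z a) (I a)) * energyI k Q I =
  \sum_(a < N.+1) \sum_(b < N.+1 | (a < b)%N) \sum_(i < 4) \sum_(j < 4)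
    lam (Q a) (z a) i * lam (Q b) (z b) j * Gk k (vert (Q a) i) (vert (Q b) j).
  under eq_bigr do rewrite mulr_sumr; rewrite exchange_big; apply: eq_bigr => a _.
  under eq_bigr do rewrite mulr_sumr; rewrite exchange_big /=; apply: eq_bigr => b ab.
  rewrite (sum_ffun_marginal2 _ _ (fun a => lam (Q a) (z a)) a b
    (fun i j => Gk k (vert (Q a) i) (vert (Q b) j))) //.
  - by move=> c; have [[_ ->]] := hlam (Q c) (vQ c) (z c) (hz c).
  - by rewrite -val_eqE /= neq_ltn ab.
rewrite sum_neq_split -sumrB; apply: ler_sum => a _; rewrite -sumrB; apply: ler_sum => b _.
exact: Gk_ge_average2.
Qed.
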